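(* Let $k$ be a positive integer and let $\vec p=(p_1,\dots,p_k)$ with $p_i>0$ and $\sum_i p_i=1$. For each $n\ge1$ let $\alpha_n$ be a mixed strategy for $n$-token competitive Knock 'em Down with die probabilities $\vec p$ (regarded as a probability measure on the set $A_n$ of normalized allocations). Suppose that $\alpha_n$ converges weakly to $\tilde\alpha$ as $n\to\infty$, where $\tilde\alpha$ is a mixed strategy for the continuous game with atomless marginals and bounded support. Then $$\liminf_{n\to\infty}\min_{\vec y\in A_n}K_n(\alpha_n,\vec y)\ \ge\ \inf_{\vec y}K(\tilde\alpha,\vec y),$$ where the infimum on the right is over all allocations $\vec y$ of the continuous game.
   Context: Continuous game: a (pure) allocation is $\vec x\in\mathbb R^k$ with $\sum_i x_i=0$. Let $Z_1,\dots,Z_k$ be independent standard normals (the same for both players), and let $T_{\vec x}=\max_i\left(\frac{x_i}{p_i}+\frac{Z_i}{\sqrt{p_i}}\right)$. Set $\Pr[\vec x\text{ beats }\vec y]=\Pr[T_{\vec x}<T_{\vec y}]+\frac12\Pr[T_{\vec x}=T_{\vec y}]$ and $K(\vec x,\vec y)=\frac12\left(\Pr[\vec x\text{ beats }\vec y]-\Pr[\vec y\text{ beats }\vec x]\right)$. Mixed strategies are Borel probability measures on allocations, with $K(\alpha,\vec y)=\int K(\vec x,\vec y)\,\alpha(d\vec x)$. $n$-token game: a token allocation is a vector $\vec\xi$ of nonnegative integers with $\sum_i\xi_i=n$. Its normalized form is $\vec x$ with $x_i=(\xi_i-p_in)/\sqrt n$, so $\sum_i x_i=0$. $A_n$ is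 the finite set of normalized allocations. Let $Y_{i,t}$, $1\le i\le k$, be independent Poisson processes with rates $p_i$ (counting die throws showing side $i$; the same for both players). The clearance time of $\vec\xi$ is $\max_i\inf\{t\ge0:Y_{i,t}\ge\xi_i\}$. For $\vec x,\vec y\in A_n$, $\Pr[\vec x\text{ beats }\vec y]$ is the probability that the clearance time of $\vec x$ is strictly smaller than that of $\vec y$ plus half the probability that they are equal, and $K_n(\vec x,\vec y)=\frac12\left(\Pr[\vec x\text{ beats }\vec y]-\Pr[\vec y\text{ beats }\vec x]\right)$. A mixed strategy $\alpha_n$ is a probability measure on $A_n$, with $K_n(\alpha_n,\vec y)=\int K_n(\vec x,\vec y)\,\alpha_n(d\vec x)$. Weak convergence means weak convergence of probability measures on $\mathbb R^k$. *)

(* Defs.v *)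
From HB Require Import structures.
From mathcomp Require Import all_boot all_order all_algebra.
From mathcomp Require Import all_classical all_reals all_analysis.
Set Implicit Arguments.
Unset Strict Implicit.
Unset Printing Implicit Defensive.
Import Order.TTheory GRing.Theory Num.Theory.
Import numFieldNormedType.Exports.
Local Open Scope classical_set_scope.
Local Open Scope ring_scope.

Notation borel_rV R k := (g_sigma_algebraType (@open 'rV[R]_k)).

Section measures_on_Rk.
Context {R : realType} {k : nat}.

Definition weak_cvg (mu_ : nat -> probability (borel_rV R k) R)
    (mu : probability (borel_rV R k) R) : Prop :=
  forall f : 'rV[R]_k -> R, continuous f -> bounded_fun f ->
    (\int[mu_ n]_x (f x)%:E)%E @[n --> \oo] --> (\int[mu]_x (f x)%:E)%E.

Definition marginal (mu : probability (borel_rV R k) R) (i : 'I_k)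
    : set R -> \bar R :=
  pushforward mu (fun x : 'rV[R]_k => x ord0 i).

Definition atomless (nu : set R -> \bar R) : Prop :=
  forall a : R, nu [set a] = 0%E.

Definition topological_support (mu : probability (borel_rV R k) R)
    : set 'rV[R]_k :=
  [set x | forall U : set 'rV[R]_k, open U -> U x -> (0 < mu U)%E].

End measures_on_Rk.

Section random_objects.
Context {d : measure_display} {T : measurableType d} {R : realType}.
Variable P : probability T R.

Definition mutually_independent (I : choiceType) (F : I -> set (set T)) : Prop :=
  forall (J : seq I) (E : I -> set T), uniq J ->
    (forall i, i \in J -> F i (E i)) ->
    P (\bigcap_(i in [set` J]) E i) = (\prod_(i <- J) P (E i))%E.

Definition sigma_of {d' : measure_display} {T' : measurableType d'}
    (X : T -> T') : set (set T) :=
  preimage_set_system [set: T] X measurable.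

Definition sigma_of_process (N : R -> {RV P >-> nat}) : set (set T) :=
  <<s \bigcup_(t in [set t : R | 0 <= t]) sigma_of (N t) >>.

(* Times are reals, but only N t for t >= 0 is constrained or used.  The
   truncated subtraction of nat is harmless because paths are nondecreasing.
   The 0 passed to poisson_prob fills an argument which it ignores. *)
Record poisson_process (lambda : R) (N : R -> {RV P >-> nat}) : Prop := {
  poisson_process0 : forall w, N 0 w = 0%N ;
  poisson_process_nd : forall w (s t : R), 0 <= s -> s <= t ->
    (N s w <= N t w)%N ;
  poisson_process_right_cont : forall w (t : R), 0 <= t ->
    N s w @[s --> t^'+] --> N t w ;
  poisson_process_increment : forall (s t : R), 0 <= s -> s < t ->
    forall B : set nat,
      P [set w | B (N t w - N s w)%N] = poisson_prob (lambda * (t - s)) 0 B ;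
  poisson_process_independent : forall t : nat -> R,
    0 <= t 0%N -> nondecreasing_seq t ->
    mutually_independent (fun j => sigma_of (fun w => N (t j.+1) w - N (t j) w)%N)
}.

(* The player with the smaller time wins. *)
Definition beats_prob (S S' : T -> \bar R) : R :=
  fine (P [set w | (S w < S' w)%E]) + 2^-1 * fine (P [set w | S w = S' w]).

Definition payoff (S S' : T -> \bar R) : R :=
  2^-1 * (beats_prob S S' - beats_prob S' S).

End random_objects.

Section continuous_game.
Context {R : realType} {k : nat}.
Variable p : 'I_k -> R.

Definition allocation : set 'rV[R]_k := [set x | \sum_(i < k) x ord0 i = 0].

Context {d : measure_display} {T : measurableType d} (P : probability T R).
Variable Z : 'I_k -> {RV P >-> R}.

(* The maximum is taken in \bar R so that its neutral element -oo exists; for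
   0 < k the value is real. *)
Definition cont_time (x : 'rV[R]_k) (w : T) : \bar R :=
  \big[maxe/-oo%E]_(i < k) (x ord0 i / p i + Z i w / Num.sqrt (p i))%:E.

Definition cont_payoff (x y : 'rV[R]_k) : R :=
  payoff P (cont_time x) (cont_time y).

Definition cont_mixed_payoff (mu : probability (borel_rV R k) R)
    (y : 'rV[R]_k) : \bar R :=
  (\int[mu]_x (cont_payoff x y)%:E)%E.

End continuous_game.

Section token_game.
Context {R : realType} {k : nat}.
Variable p : 'I_k -> R.
Variable n : nat.

Definition token_allocation : set ('I_k -> nat) :=
  [set xi | (\sum_(i < k) xi i)%N = n].

Definition normalize (xi : 'I_k -> nat) : 'rV[R]_k :=
  \row_(i < k) (((xi i)%:R - p i * n%:R) / Num.sqrt n%:R).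

Definition normalized_allocation : set 'rV[R]_k :=
  [set normalize xi | xi in token_allocation].

(* Inverse of normalize; on normalized allocations the truncation acts on an
   actual natural number. *)
Definition tokens (x : 'rV[R]_k) (i : 'I_k) : nat :=
  Num.truncn (x ord0 i * Num.sqrt n%:R + p i * n%:R).

Lemma normalizeK (xi : 'I_k -> nat) : (0 < n)%N -> tokens (normalize xi) = xi.
Proof.
move=> n0; apply/funext => i; rewrite /tokens mxE divfK ?subrK ?natrK//.
by rewrite gt_eqF// sqrtr_gt0 ltr0n.
Qed.

Lemma finite_normalized_allocation : finite_set normalized_allocation.
Proof.
apply: finite_image.
apply: (@sub_finite_set _ _
  [set (fun i => val (f i)) | f in [set: {ffun 'I_k -> 'I_n.+1}]]).
  move=> xi /= xin; exists [ffun i => inord (xi i)] => //.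
  apply/funext => i; rewrite ffunE /= inordK// ltnS -xin.
  by rewrite (bigD1 i)//= leq_addr.
exact/finite_image/finite_finset.
Qed.

Context {d : measure_display} {T : measurableType d} (P : probability T R).
Variable Y : 'I_k -> R -> {RV P >-> nat}.

Definition hitting_time (i : 'I_k) (m : nat) (w : T) : \bar R :=
  ereal_inf [set t%:E | t in [set t : R | 0 <= t /\ (m <= Y i t w)%N]].

Definition clearance_time (xi : 'I_k -> nat) (w : T) : \bar R :=
  \big[maxe/-oo%E]_(i < k) hitting_time i (xi i) w.

Definition token_payoff (x y : 'rV[R]_k) : R :=
  payoff P (clearance_time (tokens x)) (clearance_time (tokens y)).

Definition token_mixed_payoff (mu : probability (borel_rV R k) R)
    (y : 'rV[R]_k) : \bar R :=
  (\int[mu]_(x in normalized_allocation) (token_payoff x y)%:E)%E.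

End token_game.

(* Main.v *)
(* Write the clearance time of an allocation [x] as [n + t sqrt n].  All tokens of [x] are
   removed by then iff every count [Y i (n + t sqrt n)] reaches
   [p i * n + x i * sqrt n].  By Chebyshev's inequality that count is
   [p i * n + (g i + p i * t) sqrt n] up to [o(sqrt n)], where [g i] is the fluctuation of
   the count at time [n], so the rescaled clearance time is close to
   [T x = max_i (x i - g i) / p i].  By the central limit theorem [g i] converges to
   [- sqrt (p i) Z i], which turns [T x] into the time of the continuous game.  This gives,
   uniformly in [y] and in bounded [x],
     [P (x beats y in the token game) >= P (T x + delta < T y) - epsilon].
   The right-hand side dominates a continuous function of [x], to which weak convergence
   applies; as [delta] tends to 0 it tends to [P (T x < T y)], which is [K x y + 1/2] unless
   [x i = y i] for some [i], an event without mass since the marginals are atomless.  This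
   works locally uniformly in [y].  Allocations [y] in a compact set are handled by a finite
   cover, and the other ones have a large coordinate, hence lose almost surely, so that the
   payoff against them is close to 1/2, which is at least the infimum on the right. *)

Require Import Defs.
From HB Require Import structures.
From mathcomp Require Import all_boot all_order all_algebra.
From mathcomp Require Import all_classical all_reals all_analysis.
From mathcomp Require Import measurable_realfun ring lra zify.
Import Order.TTheory GRing.Theory Num.Theory.
Import numFieldNormedType.Exports.
Local Open Scope classical_set_scope.
Local Open Scope ring_scope.

(** The two games live on unrelated probability spaces, and no joint realization of counts and
    normals is constructed. An event of one space is compared with an event of the other through an
    implication between points with close noise vectors. This consumes only independence and the
    convergence of one-dimensional distribution functions. That convergence comes from fixing the
    index [m] and letting the Poisson rate vary. The probability of at most [m] events is a
    differentiable function of the rate whose derivative is a single Poisson weight, so the limit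
    theorem becomes a comparison of two smooth functions on an interval. The continuous payoff can
    jump in [x] where ties have positive probability, so it is no test function for weak
    convergence. Since only a lower bound is claimed, a win may be replaced by a win with a positive
    margin; the margin absorbs the discretization of time, the exchange of the noise and the
    displacement of [y]. *)

(** * Monotonicity from the sign of a derivative *)

Lemma derive_sign_ge {R : realType} (f df : R -> R) (a b : R) : a <= b ->
  (forall x, a <= x <= b -> is_derive x 1 f (df x)) ->
  (forall x, a <= x <= b -> 0 <= df x) -> f a <= f b.
Proof.
move=> ab Hd Hs.
have [||c cab E] := @MVT_segment R f df a b ab.
- by move=> x; rewrite in_itv/= => /andP[/ltW ? /ltW ?]; apply: Hd; apply/andP.
- by apply: derivable_within_continuous => x; rewrite in_itv/= => H; case: (Hd _ H).
rewrite -subr_ge0 E mulr_ge0 ?subr_ge0//; apply: Hs.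
by move: cab; rewrite in_itv.
Qed.

Lemma derive_sign_le {R : realType} (f df : R -> R) (a b : R) : a <= b ->
  (forall x, a <= x <= b -> is_derive x 1 f (df x)) ->
  (forall x, a <= x <= b -> df x <= 0) -> f b <= f a.
Proof.
move=> ab Hd Hs; rewrite -lerN2.
apply: (@derive_sign_ge _ (fun x => - f x) (fun x => - df x)) => // x xab.
  by have := Hd _ xab => ?; exact: is_deriveN.
by rewrite oppr_ge0; exact: Hs.
Qed.

(** * Poisson distribution functions *)

(** The formula is kept for every real rate, without the positivity test built into [poisson_pmf],
    so that it can be differentiated in [l] everywhere. *)
Definition poisson_weight {R : realType} (m : nat) (l : R) : R :=
  l ^+ m / m`!%:R * expR (- l).

Definition poisson_cdf {R : realType} (m : nat) (l : R) : R :=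
  \sum_(j < m.+1) poisson_weight j l.

Section poisson_weight.
Context {R : realType}.
Implicit Types l x : R.

Lemma poisson_weight_ge0 m l : 0 <= l -> 0 <= poisson_weight m l.
Proof. by move=> l0; rewrite !mulr_ge0 ?expR_ge0 ?exprn_ge0 ?invr_ge0. Qed.

Lemma poisson_weightS m l : m.+1%:R * poisson_weight m.+1 l = l * poisson_weight m l.
Proof.
rewrite /poisson_weight factS exprS natrM.
have m1 : m.+1%:R != 0 :> R by rewrite pnatr_eq0.
have m2 : m`!%:R != 0 :> R by rewrite pnatr_eq0 -lt0n fact_gt0.
by field; rewrite m2 nat1r.
Qed.

Lemma is_derive_expRN l : is_derive l 1 (fun x : R => expR (- x)) (- expR (- l)).
Proof.
have h := @is_derive1_comp R expR (fun x => - x) l (expR (- l)) (- 1) _ _.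
apply: (is_derive_eq (h _ _)) => //; last by rewrite mulrN1.
Qed.

Lemma is_derive_poisson_weight0 l :
  is_derive l 1 (@poisson_weight R 0) (- poisson_weight 0 l).
Proof.
rewrite /poisson_weight fact0.
have -> : (fun l : R => l ^+ 0 / 1%:R * expR (- l)) = (fun l => expR (- l)).
  by apply/funext => x; rewrite expr0 divr1 mul1r.
by rewrite expr0 divr1 mul1r; exact: is_derive_expRN.
Qed.

Lemma is_derive_poisson_weightS m l :
  is_derive l 1 (@poisson_weight R m.+1) (poisson_weight m l - poisson_weight m.+1 l).
Proof.
have h1 : is_derive l 1 (fun x : R => x ^+ m.+1) (m.+1%:R * l ^+ m).
  have h := @is_deriveX R R id m.+1 l 1 1 (is_derive_id _ _).
  rewrite exprfctE in h; apply: (is_derive_eq h).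
  by rewrite /GRing.scale /= mulr1.
have h2 := is_derive_expRN l.
have h3 := @is_deriveZ R _ _ _ (m.+1`!%:R^-1) l 1 _ (is_deriveM h1 h2).
have hE : @poisson_weight R m.+1 =
    m.+1`!%:R^-1 *: ((fun x : R => x ^+ m.+1) * (fun x : R => expR (- x))).
  by apply/funext => x; rewrite /poisson_weight /= mulrAC mulrC.
rewrite [X in is_derive _ _ X _]hE; apply: is_derive_eq h3 _.
rewrite /poisson_weight /GRing.scale /= factS exprS natrM.
have m1 : m.+1%:R != 0 :> R by rewrite pnatr_eq0.
have m2 : m`!%:R != 0 :> R by rewrite pnatr_eq0 -lt0n fact_gt0.
by field; rewrite m2 nat1r.
Qed.

(** The derivatives of consecutive weights telescope and only the last weight is left. As a function
    of the rate, the cdf is the upper tail of a gamma distribution. *)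
Lemma is_derive_poisson_cdf m l :
  is_derive l 1 (@poisson_cdf R m) (- poisson_weight m l).
Proof.
elim: m => [|m IH].
  have -> : @poisson_cdf R 0 = @poisson_weight R 0.
    by apply/funext => x; rewrite /poisson_cdf big_ord1.
  exact: is_derive_poisson_weight0.
have -> : @poisson_cdf R m.+1 = @poisson_cdf R m + @poisson_weight R m.+1.
  by apply/funext => x; rewrite /poisson_cdf big_ord_recr.
apply: is_derive_eq (is_deriveD IH (is_derive_poisson_weightS m l)) _.
by ring.
Qed.

Lemma poisson_cdf_ge0 m l : 0 <= l -> 0 <= poisson_cdf m l.
Proof. by move=> l0; apply: sumr_ge0 => i _; exact: poisson_weight_ge0. Qed.

Lemma poisson_cdf_at0 m : poisson_cdf m (0 : R) = 1.
Proof.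
rewrite /poisson_cdf big_ord_recl big1 ?addr0.
  by rewrite /poisson_weight expr0 fact0 oppr0 expR0 divr1 mulr1.
by move=> i _; rewrite /poisson_weight /= expr0n /= !mul0r.
Qed.

Lemma poisson_cdf_nincr m (a b : R) : 0 <= a -> a <= b ->
  poisson_cdf m b <= poisson_cdf m a.
Proof.
move=> a0 ab; apply: (@derive_sign_le _ _ (fun l => - poisson_weight m l)) => //.
- by move=> x _; exact: is_derive_poisson_cdf.
- move=> x /andP[ax _]; rewrite oppr_le0 poisson_weight_ge0 //.
  exact: le_trans ax.
Qed.

Lemma poisson_cdf_le1 m (l : R) : 0 <= l -> poisson_cdf m l <= 1.
Proof. by move=> l0; rewrite -(poisson_cdf_at0 m); exact: poisson_cdf_nincr. Qed.

(* The truncated second moment has a closed form, which gives Chebyshev's inequality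
   without infinite sums of moments. *)
Lemma poisson_truncated_variance m (l : R) :
  \sum_(j < m.+2) (j%:R - l) ^+ 2 * poisson_weight j l =
  l * poisson_cdf m l + l * poisson_weight m.+1 l * (l - m.+1%:R).
Proof.
elim: m => [|m IH].
  rewrite /poisson_cdf !big_ord_recl !big_ord0 /=.
  have := poisson_weightS 0 l; rewrite mul1r => ->.
  by rewrite /bump /= addn0; ring.
rewrite big_ord_recr IH /= {2}/poisson_cdf big_ord_recr -/(poisson_cdf m l) /=.
have E := poisson_weightS m.+1 l.
rewrite -[m.+2%:R]natr1 in E *.
set w := poisson_weight m.+2 l in E *; set u := poisson_weight m.+1 l in E *.
set c := poisson_cdf m l; set a := m.+1%:R in E *.
apply/subr0_eq.
have -> : l * c + l * u * (l - a) + (a + 1 - l) ^+ 2 * w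
    - (l * (c + u) + l * w * (l - (a + 1))) = (l - a - 1) * (l * u - (a + 1) * w).
  by ring.
by rewrite E subrr mulr0.
Qed.

(** Once [m.+1] reaches the mean, the boundary term of the closed form is nonpositive, which leaves
    the variance [l] as a bound. *)
Lemma poisson_truncated_variance_le m (l : R) : 0 <= l -> l <= m.+1%:R ->
  \sum_(j < m.+2) (j%:R - l) ^+ 2 * poisson_weight j l <= l.
Proof.
move=> l0 lm; rewrite poisson_truncated_variance -[leRHS]addr0 lerD//.
  by rewrite ler_piMr// poisson_cdf_le1.
by apply: mulr_ge0_le0; [apply: mulr_ge0 => //; exact: poisson_weight_ge0|rewrite subr_le0].
Qed.
End poisson_weight.

Lemma poisson_prob_cdf {R : realType} (m : nat) (l : R) : 0 < l ->
  poisson_prob l 0 [set j | (j <= m)%N] = (poisson_cdf m l)%:E.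
Proof.
move=> l0; rewrite /poisson_prob l0 esum_fset.
- rewrite (_ : [set j | _] = `I_m.+1)// -fsbig_ord sumEFin.
  by congr EFin; apply: eq_bigr => i _; rewrite /poisson_pmf l0.
- exact: (finite_II m.+1).
- by move=> i _; rewrite lee_fin poisson_pmf_ge0.
Qed.

Lemma poisson_prob_chebyshev {R : realType} (l a : R) : 0 < l -> 0 < a ->
  (poisson_prob l 0 [set j : nat | (a <= `|j%:R - l|)%R] <= (l / a ^+ 2)%:E)%E.
Proof.
move=> l0 a0; rewrite /poisson_prob l0 esum_mkcond.
apply: (@le_trans _ _ (\esum_(j in [set: nat])
    ((j%:R - l) ^+ 2 * poisson_weight j l / a ^+ 2)%:E)).
  apply: le_esum => j _; case: ifPn => [/set_mem /= aj|_]; rewrite lee_fin.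
    rewrite /poisson_pmf l0 -/(poisson_weight j l) mulrAC ler_peMl//.
      by rewrite poisson_weight_ge0// ltW.
    rewrite ler_pdivlMr ?exprn_gt0// mul1r -(real_normK (num_real (_ - l))).
    by rewrite lerXn2r// nnegrE ltW.
  by rewrite divr_ge0 ?sqr_ge0// mulr_ge0 ?sqr_ge0// poisson_weight_ge0// ltW.
have w0 j : (0 <= ((j%:R - l) ^+ 2 * poisson_weight j l / a ^+ 2)%:E)%E.
  by rewrite lee_fin divr_ge0 ?sqr_ge0// mulr_ge0 ?sqr_ge0// poisson_weight_ge0// ltW.
rewrite -nneseries_esumT//; apply: lime_le; first exact: is_cvg_nneseries.
(* The bound on partial sums requires a truncation beyond the mean [l], which is enough for the
   limit. *)
exists (Num.truncn l).+3 => // n /= ln.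
have [m nm] : exists m, n = m.+2 by case: n ln => [|[|n]]//; exists n.
rewrite big_mkord sumEFin lee_fin nm -mulr_suml ler_pM2r ?invr_gt0 ?exprn_gt0//.
apply: poisson_truncated_variance_le; first exact: ltW.
rewrite (le_trans (ltW (truncnS_gt l)))// ler_nat.
by move: ln; rewrite nm !ltnS => /ltnW.
Qed.

(** * The central limit theorem for Poisson variables *)

Definition normal_cdf {R : realType} (x : R) : R := fine (normal_prob 0 1 `]-oo, x]).

Section normal_cdf.
Context {R : realType}.
Implicit Types x : R.

Lemma is_derive_normal_cdf x : is_derive x 1 (@normal_cdf R) (normal_pdf 0 1 x).
Proof.
have h := @continuous_FTC1 R (normal_pdf 0 1) -oo%O x (x + 1).
have [||||hd he] := h.
- by rewrite ltrDl.
- apply: (integrableS measurableT) => //.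
  exact: integrable_normal_pdf.
- exact: ltNyr.
- exact/continuous_normal_pdf/oner_neq0.
by have /derivableP H := hd; move: H; rewrite -derive1E he.
Qed.

Lemma normal_cdf_EFin x : normal_prob 0 1 `]-oo, x] = (normal_cdf x)%:E.
Proof. by rewrite /normal_cdf fineK// fin_num_measure. Qed.

Lemma normal_cdf_ge0 x : 0 <= normal_cdf x.
Proof. by rewrite /normal_cdf fine_ge0. Qed.

Lemma normal_cdf_le1 x : normal_cdf x <= 1.
Proof. by rewrite -lee_fin -normal_cdf_EFin probability_le1. Qed.

(** The identity becomes a random variable under the normal law, so that the general limits of [cdf]
    at both infinities apply to [normal_cdf]. *)
Let idTR : measurableTypeR R -> R := idfun.

#[local] HB.instance Definition _ :=
  @isMeasurableFun.Build _ _ _ _ idTR (@measurable_id _ _ setT).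

Let X : {RV (normal_prob 0 1 : probability _ R) >-> R} := idTR.

Let cdfE : cdf X = (fun x => normal_prob 0 1 `]-oo, x]).
Proof. by apply/funext => x; rewrite /cdf /distribution /pushforward /=. Qed.

Lemma normal_cdf_y : @normal_cdf R x @[x --> +oo] --> (1 : R).
Proof. by apply: fine_cvg; have := cvg_cdfy1 X; rewrite cdfE. Qed.

Lemma normal_cdf_Ny : @normal_cdf R x @[x --> -oo] --> (0 : R).
Proof. by apply: fine_cvg; have := cvg_cdfNy0 X; rewrite cdfE. Qed.

Lemma normal_cdf_continuous : continuous (@normal_cdf R).
Proof.
move=> x; apply: differentiable_continuous; apply/derivable1_diffP.
by case: (is_derive_normal_cdf x).
Qed.

Lemma normal_pdf_std x :
  normal_pdf 0 1 x = normal_peak 1 * expR (- (x ^+ 2 / 2)) :> R.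
Proof.
by rewrite normal_pdfE ?oner_eq0// /normal_fun subr0 expr1n mulNr.
Qed.
End normal_cdf.

Section poisson_normal_limit.
Context {R : realType}.
Variable m' : nat.
Let m := m'.+1.
Let s : R := Num.sqrt m%:R.

(** The index [m] is fixed and the mean [m + v s] moves, so the limit for large [m] is the
    decreasing function [1 - normal_cdf v]. Outside the section the integer argument is [m'], the
    predecessor of the index, which keeps [s] positive. *)
Definition standardized_poisson_cdf (v : R) : R := poisson_cdf m (m%:R + v * s).
Local Notation F := standardized_poisson_cdf.

Let s0 : 0 < s. Proof. by rewrite sqrtr_gt0 ltr0n. Qed.
Let ss : s ^+ 2 = m%:R. Proof. by rewrite sqr_sqrtr. Qed.
Let arg (v : R) : m%:R + v * s = s * (s + v).
Proof. by rewrite -ss; ring. Qed.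

Let is_derive_arg (v : R) : is_derive v 1 (fun x : R => m%:R + x * s) s.
Proof.
have h := is_deriveD (is_derive_cst (m%:R : R) v 1)
  (is_deriveM (is_derive_id v 1) (is_derive_cst s v 1)).
apply: is_derive_eq h _.
by rewrite /GRing.scale /=; ring.
Qed.

Lemma is_derive_standardized_poisson_cdf (v : R) :
  is_derive v 1 F (- (s * poisson_weight m (m%:R + v * s))).
Proof.
have h := @is_derive1_comp R (poisson_cdf m) (fun x : R => m%:R + x * s) v _ _ (is_derive_poisson_cdf m (m%:R + v * s)) (is_derive_arg v).
by apply: is_derive_eq h _; rewrite mulNr mulrC.
Qed.

(* [E v] is the ratio of [- F' v] to [expR (- v ^+ 2 / 2)].  Its logarithmic derivative
   [v ^+ 2 / (s + v)] is small, so on a bounded interval [- F'] is the normal density up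
   to a constant [kappa] and a factor close to 1.  No Stirling formula is needed: Chebyshev
   bounds for the tails force [kappa] to be close to 1. *)
Let E (v : R) := s * poisson_weight m (m%:R + v * s) * expR (v ^+ 2 / 2).

Let is_derive_E (v : R) : s + v != 0 -> is_derive v 1 E (E v * (v ^+ 2 / (s + v))).
Proof.
move=> sv.
have h1 := @is_derive1_comp R (poisson_weight m) (fun x : R => m%:R + x * s) v _ _ (is_derive_poisson_weightS m' (m%:R + v * s)) (is_derive_arg v).
have h2 : is_derive v 1 (fun x : R => x ^+ 2 / 2) v.
  have h := @is_deriveX R R id 2 v 1 1 (is_derive_id _ _).
  rewrite exprfctE in h.
  have h' := is_deriveM h (is_derive_cst (2^-1 : R) v 1).
  by apply: is_derive_eq h' _; rewrite /GRing.scale /=; field.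
have h3 := @is_derive1_comp R expR (fun x : R => x ^+ 2 / 2) v _ _ (is_derive_expR (v ^+ 2 / 2)) h2.
have h4 := is_deriveM (is_deriveZ s h1) h3.
apply: is_derive_eq h4 _; rewrite /E /GRing.scale /=.
have := poisson_weightS m' (m%:R + v * s); rewrite -/m.
set w := poisson_weight m' _; set u := poisson_weight m _.
set e := expR _.
rewrite arg -ss => H.
have -> : w = u * s / (s + v).
  apply: (mulfI (mulf_neq0 (lt0r_neq0 s0) sv)); rewrite -H.
  by field.
by rewrite -[s *: u]/(s * u); field.
Qed.

Lemma standardized_poisson_cdf_ge0 (v : R) : 0 <= s + v -> 0 <= F v.
Proof.
by move=> sv; rewrite /F arg poisson_cdf_ge0// mulr_ge0// ltW.
Qed.

Lemma standardized_poisson_cdf_le1 (v : R) : 0 <= s + v -> F v <= 1.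
Proof.
by move=> sv; rewrite /F arg poisson_cdf_le1// mulr_ge0// ltW.
Qed.

Section comparison.
Variable L : R.
Hypotheses (L0 : 0 < L) (Ls : 2 * L <= s).

Let half_le (v : R) : - L <= v <= L -> s / 2 <= s + v.
Proof. by move=> /andP[a b]; move: L0 Ls; lra. Qed.

Let sv0 (v : R) : - L <= v <= L -> 0 < s + v.
Proof. by move=> /half_le; apply: lt_le_trans; rewrite divr_gt0. Qed.

Let E_ge0 (v : R) : - L <= v <= L -> 0 <= E v.
Proof.
move=> vL; rewrite /E mulr_ge0 ?expR_ge0// mulr_ge0 ?poisson_weight_ge0 ?(ltW s0)//.
by rewrite arg mulr_ge0 ?ltW// sv0.
Qed.

(** A bound on the logarithmic derivative [v ^+ 2 / (s + v)]: the numerator is at most [L ^+ 2] and,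
    by [Ls], the denominator is at least [s / 2]. *)
Let theta := 2 * L ^+ 2 / s.

Let theta_ge0 : 0 <= theta.
Proof. by rewrite divr_ge0 ?mulr_ge0 ?sqr_ge0// ltW. Qed.

Let E_nd (a b : R) : - L <= a -> a <= b -> b <= L -> E a <= E b.
Proof.
move=> La ab bL.
apply: (@derive_sign_ge _ _ (fun v => E v * (v ^+ 2 / (s + v)))) => // v /andP[av vb].
  by apply/is_derive_E/lt0r_neq0/sv0/andP; split; move: L0 Ls; lra.
have vL : - L <= v <= L by apply/andP; split; move: L0 Ls; lra.
by rewrite mulr_ge0 ?E_ge0// divr_ge0 ?sqr_ge0// ltW// sv0.
Qed.

(** A logarithmic derivative of at most [theta] lets [E] grow no faster than [expR (theta * v)].
    With [E_nd], this keeps [E] within a factor [expR (theta * L)] of [E 0]. *)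
Let E_ni (a b : R) : - L <= a -> a <= b -> b <= L ->
  E b * expR (- (theta * b)) <= E a * expR (- (theta * a)).
Proof.
move=> La ab bL.
apply: (@derive_sign_le _ (fun v => E v * expR (- (theta * v)))
  (fun v => E v * expR (- (theta * v)) * (v ^+ 2 / (s + v) - theta))) => // v /andP[av vb].
  have vL : - L <= v <= L by apply/andP; split; move: L0 Ls; lra.
  have h1 := is_derive_E v (lt0r_neq0 (sv0 v vL)).
  have h2 : is_derive v 1 (fun x : R => - (theta * x)) (- theta).
    have h := is_deriveN (is_deriveZ theta (is_derive_id v (1 : R))).
    by apply: is_derive_eq h _; rewrite /GRing.scale /= mulr1.
  have h3 := @is_derive1_comp R expR (fun x : R => - (theta * x)) v _ _ (is_derive_expR (- (theta * v))) h2.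
  by apply: is_derive_eq (is_deriveM h1 h3) _; rewrite /GRing.scale /=; ring.
have vL : - L <= v <= L by apply/andP; split; move: L0 Ls; lra.
apply: mulr_ge0_le0; first by rewrite mulr_ge0 ?E_ge0 ?expR_ge0.
rewrite subr_le0.
rewrite ler_pdivrMr ?sv0//; apply: (@le_trans _ _ (theta * (s / 2))).
  have -> : theta * (s / 2) = L ^+ 2 by rewrite /theta; field; exact: lt0r_neq0.
  by move: vL; rewrite -ler_norml => vL; rewrite -(real_normK (num_real v)) lerXn2r// nnegrE ltW.
by rewrite ler_wpM2l ?half_le.
Qed.

Let beta := expR (theta * L).

Let E_le (v : R) : - L <= v <= L -> E v <= E 0 * beta.
Proof.
move=> /andP[Lv vL]; have [v0|v0] := leP 0 v.
  have : E v * expR (- (theta * v)) <= E 0 * expR (- (theta * 0)) by apply: E_ni => //; move: L0 Ls; lra.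
  rewrite mulr0 oppr0 expR0 mulr1 expRN ler_pdivrMr ?expR_gt0// => /le_trans; apply.
  rewrite ler_wpM2l ?E_ge0//; first by apply/andP; split; move: L0 Ls; lra.
  by rewrite ler_expR ler_wpM2l.
apply: (@le_trans _ _ (E 0)); first by apply: E_nd => //; move: L0 Ls; lra.
rewrite ler_peMr ?E_ge0//; first by apply/andP; split; move: L0 Ls; lra.
by rewrite -expR0 ler_expR mulr_ge0// ltW.
Qed.

Let E_ge (v : R) : - L <= v <= L -> E 0 <= E v * beta.
Proof.
move=> vL; have Ev := E_ge0 v vL; move: vL => /andP[Lv vL].
have [v0|v0] := leP 0 v.
  apply: (@le_trans _ _ (E v)); first by apply: E_nd => //; move: L0 Ls; lra.
  rewrite ler_peMr// -expR0 ler_expR.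
  by rewrite mulr_ge0// ltW.
have : E 0 * expR (- (theta * 0)) <= E v * expR (- (theta * v)) by apply: E_ni => //; move: L0 Ls; lra.
rewrite mulr0 oppr0 expR0 mulr1 => /le_trans; apply.
rewrite ler_wpM2l// ler_expR -mulrN ler_wpM2l//; lra.
Qed.

Let kappa := E 0 / normal_peak 1.

Let peak_gt0 : 0 < normal_peak 1 :> R. Proof. exact: normal_peak_gt0. Qed.

Let DE (v : R) : s * poisson_weight m (m%:R + v * s) = E v * expR (- (v ^+ 2 / 2)).
Proof. by rewrite /E expRN mulfK// gt_eqF// expR_gt0. Qed.

Let kappa_pdf (v : R) : kappa * normal_pdf 0 1 v = E 0 * expR (- (v ^+ 2 / 2)).
Proof. by rewrite normal_pdf_std /kappa; field; exact: lt0r_neq0. Qed.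

(** Each inequality is the monotonicity of a combination of [F] and [normal_cdf], whose derivative
    has the sign given by [E_le] or [E_ge]. The formula of [kappa] is hidden: applying the bounds
    between the two tails determines its approximate value. *)
Lemma standardized_poisson_comparison :
  exists2 kappa, 0 <= kappa & forall a b : R, - L <= a -> a <= b -> b <= L ->
    F a - F b <= kappa * expR (2 * L ^+ 3 / s) * (normal_cdf b - normal_cdf a) /\
    kappa * (normal_cdf b - normal_cdf a) <= expR (2 * L ^+ 3 / s) * (F a - F b).
Proof.
have betaE : expR (2 * L ^+ 3 / s) = beta.
  by rewrite /beta /theta; congr expR; ring.
exists kappa.
  by rewrite divr_ge0 ?E_ge0 ?(ltW peak_gt0)//; apply/andP; split; move: L0 Ls; lra.
move=> a b La ab bL; rewrite betaE; split.
- suff : F a + kappa * beta * normal_cdf a <= F b + kappa * beta * normal_cdf b by move: L0 Ls; lra.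
  refine (@derive_sign_ge _ (fun v => F v + kappa * beta * normal_cdf v)
    (fun v => - (s * poisson_weight m (m%:R + v * s)) + kappa * beta * normal_pdf 0 1 v)
    a b ab _ _) => v.
    move=> _; have h1 := is_derive_standardized_poisson_cdf v.
    exact: is_deriveD h1 (is_deriveZ (kappa * beta) (is_derive_normal_cdf v)).
  move=> /andP[av vb]; rewrite DE (mulrAC kappa) kappa_pdf addrC subr_ge0 [leRHS]mulrAC.
  by rewrite ler_wpM2r ?expR_ge0 ?E_le//; apply/andP; split; move: L0 Ls; lra.
- rewrite -subr_ge0 (_ : beta * (F a - F b) - kappa * (normal_cdf b - normal_cdf a) = beta * F a + kappa * normal_cdf a
    - (beta * F b + kappa * normal_cdf b)); last by ring.
  rewrite subr_ge0.
  refine (@derive_sign_le _ (fun v => beta * F v + kappa * normal_cdf v)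
    (fun v => beta * - (s * poisson_weight m (m%:R + v * s)) + kappa * normal_pdf 0 1 v)
    a b ab _ _) => v.
    move=> _; have h1 := is_derive_standardized_poisson_cdf v.
    exact: is_deriveD (is_deriveZ beta h1) (is_deriveZ kappa (is_derive_normal_cdf v)).
  move=> /andP[av vb]; rewrite DE kappa_pdf mulrN addrC subr_le0 mulrA (mulrC beta).
  by rewrite ler_wpM2r ?expR_ge0 ?E_ge//; apply/andP; split; move: L0 Ls; lra.
Qed.

(** The mean [m + L s] exceeds [m] by [L s], so a count of at most [m] deviates by at least [L s].
    The variance is at most [2 s ^+ 2] because [L <= s], whence the constant 2. *)
Lemma standardized_poisson_cdf_tail : F L <= 2 / L ^+ 2.
Proof.
have l0 : 0 < m%:R + L * s by rewrite ltr_pwDl ?ltr0n// mulr_ge0// ltW.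
have a0 : 0 < L * s by rewrite mulr_gt0.
rewrite -lee_fin -poisson_prob_cdf//.
apply: (@le_trans _ _ (poisson_prob (m%:R + L * s) 0 [set j : nat | (L * s <= `|j%:R - (m%:R + L * s)|)%R])).
  apply: le_measure; rewrite ?inE// => j /= jm.
  have jm' : j%:R <= m%:R :> R by rewrite ler_nat.
  by rewrite ler0_norm; move: L0 Ls; lra.
apply: (le_trans (poisson_prob_chebyshev _ _ l0 a0)); rewrite lee_fin.
rewrite ler_pdivrMr ?exprn_gt0// exprMn ss mulrA divfK ?expf_neq0 ?gt_eqF//.
have Lss : L * s <= s ^+ 2.
  by rewrite expr2 ler_wpM2r ?(ltW s0)//; move: L0 Ls; lra.
by rewrite -ss; move: a0 Lss; lra.
Qed.

Lemma standardized_poisson_cdf_tailN : 1 - F (- L) <= 2 / L ^+ 2.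
Proof.
have l0 : 0 < m%:R + - L * s by rewrite arg mulr_gt0//; move: L0 Ls; lra.
have a0 : 0 < L * s by rewrite mulr_gt0.
rewrite -lee_fin EFinB -poisson_prob_cdf// -probability_setC//.
apply: (@le_trans _ _ (poisson_prob (m%:R + - L * s) 0 [set j : nat | (L * s <= `|j%:R - (m%:R + - L * s)|)%R])).
  apply: le_measure; rewrite ?inE// => j /= /negP; rewrite -ltnNge => jm.
  have jm' : m%:R <= j%:R :> R by rewrite ler_nat ltnW.
  by rewrite ger0_norm; move: L0 Ls; lra.
apply: (le_trans (poisson_prob_chebyshev _ _ l0 a0)); rewrite lee_fin.
rewrite ler_pdivrMr ?exprn_gt0// exprMn ss mulrA divfK ?expf_neq0 ?gt_eqF//.
have Lss : L * s <= s ^+ 2.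
  by rewrite expr2 ler_wpM2r ?(ltW s0)//; move: L0 Ls; lra.
by rewrite -ss; move: a0 Lss; lra.
Qed.
End comparison.
End poisson_normal_limit.

Lemma expR_le1D {R : realType} (x t : R) : 0 < t -> t <= 1 -> x <= t / 2 ->
  expR x <= 1 + t.
Proof.
move=> t0 t1 xt.
have := expR_ge1Dx (- x); rewrite expRN -div1r ler_pdivlMr ?expR_gt0// => h.
have e0 := expR_gt0 x.
rewrite -(@ler_pM2l _ (1 - t / 2)); last by lra.
apply: (@le_trans _ _ ((1 - x) * expR x)); first by rewrite ler_wpM2r ?(ltW e0)//; lra.
by apply: (le_trans h); nra.
Qed.

Lemma standardized_poisson_cdf_cvg {R : realType} (L e : R) : 0 < L -> 0 < e ->
  exists M, forall m, (M <= m)%N -> forall v, - L <= v <= L ->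
    `|standardized_poisson_cdf m v - (1 - normal_cdf v)| <= e.
Proof.
move=> L0 e0.
(* The errors below add up to at most [7 * t]; the bound [10^-1] keeps [1 - 2 * t] and [1 - 5 * t]
   positive and absorbs terms quadratic in [t]. *)
pose t := Num.min (e / 7) 10^-1.
have t0 : 0 < t by rewrite lt_min divr_gt0// invr_gt0 ltr0n.
have te : 7 * t <= e by rewrite mulrC -ler_pdivlMr// ge_min lexx.
have t1 : t <= 10^-1 by rewrite ge_min lexx orbT.
have [K [K0 LK Ky KNy Kt]] : exists K, [/\ 0 < K, L <= K, 1 - t <= normal_cdf K,
    normal_cdf (- K) <= t & 2 / K ^+ 2 <= t].
  have ny : \forall x \near +oo, 1 - t <= normal_cdf (x : R).
    have /cvgrPdist_le/(_ _ t0) := @normal_cdf_y R.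
    by apply: filterS => x; rewrite ger0_norm ?subr_ge0 ?normal_cdf_le1//; lra.
  have nNy : \forall x \near +oo, normal_cdf (- (x : R)) <= t.
    have /cvgNy_compNP/cvgrPdist_le/(_ _ t0) := @normal_cdf_Ny R.
    by apply: filterS => x /=; rewrite sub0r normrN ger0_norm ?normal_cdf_ge0.
  near (+oo : set_system R) => K; exists K.
  have K1 : 1 <= K by [].
  have K2 : 2 / t <= K by [].
  have K0 : 0 < K := lt_le_trans ltr01 K1.
  split; [exact: K0|by []|by near: K|by near: K|].
  rewrite ler_pdivrMr ?exprn_gt0//.
  move: K2; rewrite ler_pdivrMr// mulrC => K2; apply: (le_trans K2).
  by rewrite ler_wpM2l ?(ltW t0)// expr2 ler_peMl// (le_trans _ K1).
(* The first term ensures [2 * K <= s], the second makes the comparison factor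
   [expR (2 * K ^+ 3 / s)] at most [1 + t]. *)
pose S := 2 * K + 4 * K ^+ 3 / t.
exists (Num.truncn (S ^+ 2)) => m Mm v vL.
pose s : R := Num.sqrt m.+1%:R.
have S0 : 0 < S by rewrite addr_gt0// ?divr_gt0// mulr_gt0// exprn_gt0.
have Ss : S <= s.
  rewrite -(ger0_norm (ltW S0)) -sqrtr_sqr ler_wsqrtr// ltW//.
  by rewrite (lt_le_trans (truncnS_gt _))// ler_nat ltnS.
have s0 : 0 < s := lt_le_trans S0 Ss.
have Ks : 2 * K <= s.
  by rewrite (le_trans _ Ss)// lerDl ?divr_ge0 ?mulr_ge0// ?exprn_ge0 ltW.
have beta_le : expR (2 * K ^+ 3 / s) <= 1 + t.
  have xt : 2 * K ^+ 3 / s <= t / 2.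
    rewrite ler_pdivrMr// -ler_pdivrMl ?divr_gt0//.
    apply: (le_trans _ Ss); rewrite (_ : _^-1 * _ = 4 * K ^+ 3 / t); last first.
      by field; exact: lt0r_neq0.
    by rewrite lerDr mulr_ge0// ltW.
  by apply: (expR_le1D _ _ t0 _ xt); lra.
have beta_ge1 : 1 <= expR (2 * K ^+ 3 / s).
  by rewrite -expR0 ler_expR divr_ge0 ?mulr_ge0 ?exprn_ge0 ?ltW.
have [kappa k0 kP] := standardized_poisson_comparison m K K0 Ks.
have FK := standardized_poisson_cdf_tail m K K0 Ks.
have FNK := standardized_poisson_cdf_tailN m K K0 Ks.
have vK : - K <= v <= K by case/andP: vL => ? ?; apply/andP; split; lra.
have range x : - K <= x <= K -> 0 <= s + x by move=> /andP[? ?]; lra.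
have FK0 : 0 <= standardized_poisson_cdf m K.
  by apply: standardized_poisson_cdf_ge0; apply: range; apply/andP; split; lra.
have Fv0 : 0 <= standardized_poisson_cdf m v.
  by apply: standardized_poisson_cdf_ge0; exact: range.
have FNK1 : standardized_poisson_cdf m (- K) <= 1.
  by apply: standardized_poisson_cdf_le1; apply: range; apply/andP; split; lra.
move: beta_le beta_ge1 kP.
rewrite -/s; set beta := expR _; set F := standardized_poisson_cdf m in FK FNK FK0 Fv0 FNK1 *.
move=> beta_le beta_ge1 kP.
have [|||k1 k2] := kP (- K) K; [lra|lra|lra|].
have [|||v1 v2] := kP v K; [by case/andP: vK|by case/andP: vK|lra|].
have n1 := normal_cdf_le1 K.
have nv0 := normal_cdf_ge0 v.
have nv1 := normal_cdf_le1 v.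
have nN0 := normal_cdf_ge0 (- K).
set nK := normal_cdf K in Ky k1 k2 v1 v2 n1.
set nNK := normal_cdf (- K) in KNy k1 k2 nN0.
set nv := normal_cdf v in v1 v2 nv0 nv1 *.
(* Between [- K] and [K], [normal_cdf] rises and [F] drops by at least [1 - 2 * t], so the
   comparison over this interval pins [kappa] near 1. *)
have kb1 : kappa * (1 - 2 * t) <= 1 + t.
  apply: (@le_trans _ _ (kappa * (nK - nNK))); first by rewrite ler_wpM2l//; lra.
  apply: (le_trans k2); apply: (@le_trans _ _ (beta * 1)); last by lra.
  by rewrite ler_wpM2l//; lra.
have kb2 : 1 - 2 * t <= kappa * (1 + t).
  apply: (@le_trans _ _ (F (- K) - F K)); first by lra.
  apply: (le_trans k1); apply: (@le_trans _ _ (kappa * beta * 1)).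
    by rewrite ler_wpM2l ?mulr_ge0//; lra.
  by rewrite mulr1 ler_wpM2l.
have up : F v <= 1 - nv + 7 * t.
  have k6 : kappa * beta <= 1 + 6 * t.
    apply: (@le_trans _ _ (kappa * (1 + t))); first by rewrite ler_wpM2l.
    rewrite -(@ler_pM2r _ (1 - 2 * t)); last by lra.
    apply: (@le_trans _ _ ((1 + t) * (1 + t))); last by nra.
    by rewrite mulrAC ler_wpM2r//; lra.
  have : kappa * beta * (nK - nv) <= (1 + 6 * t) * (1 - nv).
    apply: (@le_trans _ _ (kappa * beta * (1 - nv))).
      by rewrite ler_wpM2l ?mulr_ge0//; lra.
    by rewrite ler_wpM2r//; lra.
  by nra.
have lo : 1 - nv - 7 * t <= F v.
  have [neg|pos] := leP (1 - nv - 7 * t) 0; first exact: (le_trans neg Fv0).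
  have k5 : (1 - 5 * t) * beta <= kappa.
    rewrite -(@ler_pM2r _ (1 + t)); last by lra.
    apply: (le_trans _ kb2).
    apply: (@le_trans _ _ ((1 - 5 * t) * (1 + t) * (1 + t))); last by nra.
    by rewrite ler_wpM2r ?ler_wpM2l//; lra.
  have h1 : (1 - 5 * t) * beta * (1 - t - nv) <= beta * F v.
    apply: (@le_trans _ _ (kappa * (1 - t - nv))); first by rewrite ler_wpM2r//; lra.
    apply: (@le_trans _ _ (kappa * (nK - nv))); first by rewrite ler_wpM2l//; lra.
    by apply: (le_trans v2); rewrite ler_wpM2l//; lra.
  have h2 : (1 - 5 * t) * (1 - t - nv) <= F v.
    rewrite -(@ler_pM2l _ beta); last by lra.
    by rewrite mulrA (mulrC beta).
  by nra.
by rewrite ler_distl; apply/andP; split; lra.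
Unshelve. all: by end_near. Qed.

Lemma cvg_inv_sqrtn {R : realType} : (Num.sqrt n%:R)^-1 @[n --> \oo] --> (0 : R).
Proof.
have h : (n%:R : R)^-1 @[n --> \oo] --> (0 : R).
  apply/(gtr0_cvgV0 (f := fun n => n%:R)); last exact: cvgr_idn.
  by exists 1%N => // n /=; rewrite ltr0n.
have -> : (fun n => (Num.sqrt n%:R)^-1) = Num.sqrt \o (fun n => (n%:R : R)^-1).
  by apply/funext => n /=; rewrite sqrtrV.
rewrite -[X in _ --> X](@sqrtr0 R).
exact: (continuous_cvg _ (@sqrt_continuous R 0) h).
Qed.

(* With [m] the integer part of [p n + b sqrt n], the probability is the standardized
   cdf of index [m.-1] at a point that converges to [- b / sqrt p]. *)
Lemma poisson_clt {R : realType} (p b : R) : 0 < p ->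
  fine (poisson_prob (p * n%:R) 0
    [set j : nat | (j%:R <= p * n%:R + b * Num.sqrt n%:R)%R]) @[n --> \oo]
  --> 1 - normal_cdf (- b / Num.sqrt p).
Proof.
move=> p0.
pose w n : R := (Num.sqrt n%:R)^-1.
pose x n : R := p * n%:R + b * Num.sqrt n%:R.
pose m n := Num.truncn (x n).
have w0 : w n @[n --> \oo] --> (0 : R) := cvg_inv_sqrtn.
have nw n : (0 < n)%N -> n%:R * w n ^+ 2 = 1.
  by move=> n0; rewrite exprVn sqr_sqrtr// divff// pnatr_eq0 -lt0n.
have sw n : (0 < n)%N -> Num.sqrt n%:R * w n = 1.
  by move=> n0; rewrite divff// gt_eqF// sqrtr_gt0 ltr0n.
have wge0 n : 0 <= w n by rewrite invr_ge0 sqrtr_ge0.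
have xw n : (0 < n)%N -> x n * w n ^+ 2 = p + b * w n.
  by move=> n0; rewrite mulrDl -!mulrA nw// mulr1 expr2 (mulrA (Num.sqrt _)) sw// mul1r.
have w2 : w n ^+ 2 @[n --> \oo] --> (0 : R).
  by have h := cvgM w0 w0; rewrite mulr0 in h; exact: h.
have cw : p + b * w n @[n --> \oo] --> p.
  by rewrite -[X in _ --> X]addr0 -(mulr0 b); apply: cvgD; [exact: cvg_cst|apply: cvgMr].
have pos : \forall n \near \oo, 0 < p + b * w n.
  exact: (cvgr_gt _ cw).
have xpos : \forall n \near \oo, 0 < x n.
  near=> n.
  have n0 : (0 < n)%N by near: n; exists 1%N.
  have : 0 < x n * w n ^+ 2 by rewrite xw//; near: n.
  by rewrite pmulr_lgt0// exprn_gt0// invr_gt0 sqrtr_gt0 ltr0n.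
have um : (m n)%:R * w n ^+ 2 @[n --> \oo] --> p.
  apply: (squeeze_cvgr (f := fun n => p + b * w n - w n ^+ 2) (h := fun n => p + b * w n)).
  - near=> n.
    have n0 : (0 < n)%N by near: n; exists 1%N.
    have /truncn_itv/andP[ml mr] : 0 <= x n by apply: ltW; near: n.
    rewrite -xw// -[X in _ - X]mul1r -mulrBl !ler_wpM2r ?sqr_ge0//.
    by rewrite lerBlDr natr1 ltW.
  - by rewrite -[X in _ --> X]subr0; apply: cvgB.
  - exact: cw.
have u0 : \forall n \near \oo, 0 < (m n)%:R * w n ^+ 2 by exact: (cvgr_gt _ um).
pose v n := (p * n%:R - (m n)%:R) / Num.sqrt (m n)%:R.
pose v0 := - b / Num.sqrt p.
have vv0 : v n @[n --> \oo] --> v0.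
  (* Numerator and denominator of [v n] are multiplied by [w n], after which each has a finite
     limit; the rounding error becomes at most [w n]. *)
  pose v' n := (- b + (x n - (m n)%:R) * w n) / Num.sqrt ((m n)%:R * w n ^+ 2).
  suff h : v' n @[n --> \oo] --> v0.
    apply: cvg_trans h; apply: near_eq_cvg; near=> n; rewrite /v' /v.
    have n0 : (0 < n)%N by near: n; exists 1%N.
    have wn0 : 0 < w n by rewrite invr_gt0 sqrtr_gt0 ltr0n.
    have m0 : 0 < (m n)%:R :> R.
      have : 0 < (m n)%:R * w n ^+ 2 by near: n.
      by rewrite pmulr_lgt0// exprn_gt0.
    rewrite sqrtrM ?ler0n// sqrtr_sqr ger0_norm//.
    rewrite (_ : - b + _ = (p * n%:R - (m n)%:R) * w n); last first.
      apply/subr0_eq; rewrite /x.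
      have -> : - b + (p * n%:R + b * Num.sqrt n%:R - (m n)%:R) * w n
          - (p * n%:R - (m n)%:R) * w n = b * (Num.sqrt n%:R * w n - 1) by ring.
      by rewrite sw// subrr mulr0.
    by rewrite -mulf_div divff ?mulr1// gt_eqF.
  rewrite /v0 /v' -[X in X / _](addr0 (- b)); apply: cvgM.
    apply: cvgD; first exact: cvg_cst.
    apply: (squeeze_cvgr (f := fun=> 0) (h := w)) => //; last exact: cvg_cst.
    near=> n.
    have /truncn_itv/andP[ml mr] : 0 <= x n by apply: ltW; near: n.
    rewrite mulr_ge0 ?subr_ge0//= ler_piMl// lerBlDr addrC natr1 ltW//.
  apply: cvgV; first by rewrite gt_eqF// sqrtr_gt0.
  exact: (continuous_cvg _ (@sqrt_continuous R p) um).
have nv : normal_cdf (v n) @[n --> \oo] --> normal_cdf v0.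
  exact: (continuous_cvg _ (@normal_cdf_continuous R v0) vv0).
apply/cvgrPdist_le => e e0.
have e20 : 0 < e / 2 by rewrite divr_gt0.
have nve : \forall n \near \oo, `|normal_cdf v0 - normal_cdf (v n)| <= e / 2.
  by move/cvgrPdist_le : nv => /(_ _ e20).
have L0 : 0 < `|v0| + 1 by rewrite ltr_pwDr.
have [M MP] := standardized_poisson_cdf_cvg (`|v0| + 1) (e / 2) L0 e20.
have mM : \forall n \near \oo, (M.+1 < m n)%N.
  near=> n.
  have n0 : (0 < n)%N by near: n; exists 1%N.
  rewrite -(ltr_nat R).
  have h1 : p / 2 < (m n)%:R * w n ^+ 2.
    near: n; apply: (cvgr_gt _ um); first lra.
  have h2 : M.+1%:R * w n ^+ 2 < p / 2.
    near: n; have : M.+1%:R * w n ^+ 2 @[n --> \oo] --> (0 : R).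
      by rewrite -(mulr0 M.+1%:R); apply: cvgMr.
    by move=> h; apply: (cvgr_lt _ h); rewrite divr_gt0.
  have := lt_trans h2 h1; rewrite ltr_pM2r// exprn_gt0// invr_gt0 sqrtr_gt0 ltr0n//.
near=> n.
have n0 : (0 < n)%N by near: n; exists 1%N.
have mn : (M.+1 < m n)%N by near: n.
have x0 : 0 <= x n by apply: ltW; near: n.
have pn0 : 0 < p * n%:R by rewrite mulr_gt0// ltr0n.
have -> : [set j : nat | (j%:R <= x n)%R] = [set j | (j <= m n)%N].
  by apply/seteqP; split => j /=; rewrite truncn_ge_nat.
rewrite poisson_prob_cdf//=.
have [q mq] : exists q, m n = q.+1 by exists (m n).-1; rewrite prednK// (leq_trans _ mn).
have E : poisson_cdf (m n) (p * n%:R) = standardized_poisson_cdf q (v n).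
  rewrite /standardized_poisson_cdf /v mq divfK; first by congr poisson_cdf; ring.
  by rewrite gt_eqF// sqrtr_gt0 ltr0n.
rewrite E.
have h1 : `|standardized_poisson_cdf q (v n) - (1 - normal_cdf (v n))| <= e / 2.
  apply: MP; first by move: mn; rewrite mq ltnS => /ltnW; rewrite leq_eqVlt; lia.
  rewrite -ler_norml.
  have : `|v0 - v n| <= 1 by near: n; move/cvgrPdist_le : vv0; exact.
  by move=> h; rewrite -(subrK v0 (v n)) addrC (le_trans (ler_normD _ _))// lerD2l distrC.
have h2 : `|normal_cdf v0 - normal_cdf (v n)| <= e / 2.
  by near: n.
move: h1 h2; rewrite !ler_distl => /andP[a1 a2] /andP[b1 b2].
rewrite -/v0; move: a1 a2 b1 b2; clear; set N0 := normal_cdf v0; set N := normal_cdf (v n).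
by move=> a1 a2 b1 b2; apply/andP; split; lra.
Unshelve. all: by end_near. Qed.

(** * Comparing independent vectors through boxes *)

Section measurable_levels.
Context {d : measure_display} {T : measurableType d} {R : realType}.
Variable f : T -> R.
Hypothesis mf : measurable_fun setT f.

Lemma measurable_preimage (B : set R) : measurable B -> measurable (f @^-1` B).
Proof. by move=> mB; rewrite -[X in measurable X]setTI; exact: mf. Qed.

Lemma preimage_itvNy (c : R) : f @^-1` `]-oo, c] = [set w | f w <= c].
Proof. by apply/seteqP; split => w /=; rewrite in_itv. Qed.

Lemma preimage_itvy (c : R) : f @^-1` `[c, +oo[ = [set w | c <= f w].
Proof. by apply/seteqP; split => w /=; rewrite in_itv/= andbT. Qed.

Lemma measurable_le_level (c : R) : measurable [set w | f w <= c].
Proof. by rewrite -preimage_itvNy; exact: measurable_preimage. Qed.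

Lemma measurable_ge_level (c : R) : measurable [set w | c <= f w].
Proof. by rewrite -preimage_itvy; exact: measurable_preimage. Qed.

Lemma measurable_abs_level (c : R) : measurable [set w | c <= `|f w|].
Proof.
rewrite (_ : [set w | _] = [set w | c <= f w] `|` [set w | f w <= - c]).
  by apply: measurableU; [exact: measurable_ge_level|exact: measurable_le_level].
apply/seteqP; split => w /=; first by rewrite ler_normr => /orP[|h]; [left|right; lra].
by rewrite ler_normr => -[->//|h]; apply/orP; right; lra.
Qed.
End measurable_levels.

Section real_probability.
Context {d : measure_display} {T : measurableType d} {R : realType}.
Variable P : probability T R.

Definition pr (A : set T) : R := fine (P A).

Lemma pr_EFin (A : set T) : measurable A -> P A = (pr A)%:E.
Proof. by move=> mA; rewrite /pr fineK// fin_num_measure. Qed.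

Lemma pr_ge0 (A : set T) : 0 <= pr A.
Proof. by rewrite /pr fine_ge0. Qed.

Lemma pr_le (A B : set T) : measurable A -> measurable B -> A `<=` B ->
  pr A <= pr B.
Proof.
move=> mA mB AB; rewrite -lee_fin -!pr_EFin//.
by apply: le_measure; rewrite ?inE.
Qed.

Lemma pr_le1 (A : set T) : measurable A -> pr A <= 1.
Proof. by move=> mA; rewrite -lee_fin -pr_EFin// probability_le1. Qed.

Lemma pr_set0 : pr set0 = 0.
Proof. by rewrite /pr measure0. Qed.

Lemma pr_setU (A B : set T) : measurable A -> measurable B -> A `&` B = set0 ->
  pr (A `|` B) = pr A + pr B.
Proof.
move=> mA mB AB; apply: EFin_inj; rewrite EFinD -!pr_EFin//; last exact: measurableU.
by rewrite measureU.
Qed.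

Lemma pr_setDK (A B : set T) : measurable A -> measurable B -> A `<=` B ->
  pr A + pr (B `\` A) = pr B.
Proof.
move=> mA mB AB; by rewrite -pr_setU ?setDUK ?setDIK//; exact: measurableD.
Qed.

Lemma pr_setC (A : set T) : measurable A -> pr (~` A) = 1 - pr A.
Proof.
move=> mA; apply: EFin_inj; rewrite EFinB -!pr_EFin//; last exact: measurableC.
by rewrite probability_setC.
Qed.

Lemma pr_setU_le (A B : set T) : measurable A -> measurable B ->
  pr (A `|` B) <= pr A + pr B.
Proof.
move=> mA mB; rewrite -lee_fin EFinD -!pr_EFin//; last exact: measurableU.
exact: measureU2.
Qed.

Lemma pr_bigsetU_le (I : Type) (s : seq I) (A : I -> set T) :
  (forall i, measurable (A i)) ->
  pr (\big[setU/set0]_(i <- s) A i) <= \sum_(i <- s) pr (A i).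
Proof.
move=> mA; elim: s => [|i s IH]; first by rewrite !big_nil pr_set0.
rewrite !big_cons (le_trans (pr_setU_le _ _ _ _))//.
  exact: bigsetU_measurable.
by rewrite lerD2l.
Qed.

Lemma pr_sum_disjoint_le (I : eqType) (s : seq I) (A : I -> set T) (B : set T) :
  (forall i, measurable (A i)) -> measurable B -> uniq s ->
  (forall i j, i != j -> A i `&` A j = set0) ->
  (forall i, i \in s -> A i `<=` B) ->
  \sum_(i <- s) pr (A i) <= pr B.
Proof.
move=> mA + + dA; elim: s B => [|i s IH] B mB; first by rewrite big_nil pr_ge0.
rewrite cons_uniq => /andP[si us] AB; rewrite big_cons.
rewrite -(pr_setDK (A i) B)//; last by apply: AB; rewrite mem_head.
rewrite lerD2l; apply: IH => //; first exact: measurableD.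
move=> j js w Ajw; split; first by apply: (AB j) => //; rewrite in_cons js orbT.
move=> Aiw; have ij : i != j by apply: contraNneq si => ->.
have : (A i `&` A j) w by [].
by rewrite dA.
Qed.

Lemma pr_abs_tail (f : T -> R) : measurable_fun setT f -> forall e, 0 < e ->
  \forall K \near +oo, pr [set w | K <= `|f w|] <= e.
Proof.
move=> mf e e0.
have mA (K : R) : measurable [set w | K <= `|f w|] by exact: measurable_abs_level.
have : (P \o (fun n : nat => [set w | n%:R <= `|f w|])) n @[n --> \oo] --> (0 : \bar R).
  rewrite -(measure0 P) (_ : set0 = \bigcap_(n : nat) [set w | n%:R <= `|f w|]).
    apply: nonincreasing_cvg_mu.
    - by rewrite (le_lt_trans (probability_le1 _ _))// ltry.
    - by [].
    - exact: bigcapT_measurable.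
    - move=> n m nm; apply/subsetPset => w /=; apply: le_trans.
      by rewrite ler_nat.
  apply/seteqP; split => // w /(_ (Num.truncn `|f w|).+1 I) /=.
  by rewrite leNgt truncnS_gt.
move=> /fine_cvgP[_ /cvgrPdist_le /(_ _ e0)] [N _ NP].
exists N%:R; split; first exact: num_real.
move=> K /= NK.
apply: (@le_trans _ _ (pr [set w | N%:R <= `|f w|])).
  by apply: pr_le => // w /=; apply: le_trans; exact: ltW.
by have := NP N (leqnn N); rewrite /= sub0r normrN ger0_norm ?fine_ge0.
Qed.
End real_probability.

Section box_coupling.
Context {R : realType} {k : nat}.
Context {d1 d2 : measure_display} {T1 : measurableType d1} {T2 : measurableType d2}.
Variables (P1 : probability T1 R) (P2 : probability T2 R).

(** The product rule over all coordinates at once; taking [setT] for some of the [B i] yields it for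
    subfamilies. *)
Definition independent_coordinates d (T : measurableType d) (P : probability T R)
    (X : 'I_k -> T -> R) : Prop :=
  forall B : 'I_k -> set R, (forall i, measurable (B i)) ->
  P (\bigcap_(i in [set: 'I_k]) X i @^-1` B i) = (\prod_(i < k) P (X i @^-1` B i))%E.

Variables (X : 'I_k -> T1 -> R) (G : nat -> 'I_k -> T2 -> R).
Hypotheses (mX : forall i, measurable_fun setT (X i))
  (mG : forall n i, measurable_fun setT (G n i))
  (iX : independent_coordinates _ _ P1 X)
  (iG : forall n, independent_coordinates _ _ P2 (G n))
  (cvgG : forall i b, pr P2 [set w | G n i w <= b] @[n --> \oo] -->
     pr P1 [set w | X i w <= b]).

Let pr_itv d (T : measurableType d) (P : probability T R) (f : T -> R) (a b : R) :
  measurable_fun setT f -> a <= b ->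
  pr P (f @^-1` `]a, b]) = pr P [set w | f w <= b] - pr P [set w | f w <= a].
Proof.
move=> mf ab.
have <- : pr P [set w | f w <= a] + pr P ([set w | f w <= b] `\` [set w | f w <= a]) =
    pr P [set w | f w <= b].
  apply: pr_setDK; [exact: measurable_le_level|exact: measurable_le_level|].
  by move=> w /= /le_trans; apply.
rewrite addrAC subrr add0r; congr pr; apply/seteqP; split => w /=; rewrite !in_itv/=.
  by move=> /andP[aw wb]; split=> //; apply/negP; rewrite -ltNge.
by move=> [wb /negP]; rewrite -ltNge => ->.
Qed.

Variable h : R.
Hypothesis h0 : 0 < h.

(** Half-open intervals are disjoint, and their probability is a difference of two values of the
    distribution function. *)
Let cell (K : R) (j : nat) : set R := `](- K + j%:R * h), (- K + j.+1%:R * h)].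

Let pr_box d (T : measurableType d) (P : probability T R) (f : 'I_k -> T -> R) K m
    (c : {ffun 'I_k -> 'I_m}) :
  (forall i, measurable_fun setT (f i)) -> independent_coordinates _ _ P f ->
  pr P (\bigcap_(i in [set: 'I_k]) f i @^-1` cell K (c i)) =
  \prod_(i < k) (pr P [set w | f i w <= - K + (c i).+1%:R * h]
    - pr P [set w | f i w <= - K + (c i)%:R * h]).
Proof.
move=> mf indf; rewrite /pr (indf (fun i => cell K (c i)))//; last first.
  by move=> i; exact: measurable_itv.
transitivity (fine (\prod_(i < k) (pr P (f i @^-1` cell K (c i)))%:E)%E).
  congr fine; apply: eq_bigr => i _; rewrite pr_EFin//.
  exact: (measurable_preimage _ (mf i) _ (measurable_itv _)).
rewrite prodEFin /=; apply: eq_bigr => i _.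
by rewrite pr_itv// lerD2l ler_wpM2r ?(ltW h0)// ler_nat.
Qed.

(* Cut [R^k] into boxes of side [h].  By independence the box probabilities are products
   of one-dimensional ones, so they converge; [A] is covered by the boxes that it meets,
   up to a tail, and [B] contains the corresponding boxes for [G n]. *)
Lemma box_coupling (e : R) : 0 < e -> exists C : R, \forall n \near \oo,
  forall (A : set T1) (B : set T2), measurable A -> measurable B ->
  (forall w w', A w -> (forall i, `|X i w - G n i w'| <= h) ->
     (forall i, `|G n i w'| <= C) -> B w') ->
  pr P1 A <= pr P2 B + e.
Proof.
move=> e0.
have k1 : 0 < (k.+1)%:R :> R by rewrite ltr0n.
(* Half of [e] pays for the tail and is shared among the coordinates, the other half is shared among
   the boxes; the successors only avoid zero denominators. *)
have [K [K0 KP]] : exists K : R, 0 < K /\ forall i, pr P1 [set w | K <= `|X i w|] <= e / 2 / k.+1%:R.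
  near (+oo : set_system R) => K; exists K; split.
    by near: K; exact: nbhs_pinfty_gt.
  near: K; apply: filter_forall => i.
  by apply: pr_abs_tail => //; rewrite !divr_gt0.
pose m := (Num.truncn (2 * K / h)).+1.
pose boxX c := \bigcap_(i in [set: 'I_k]) X i @^-1` cell K ((c : {ffun 'I_k -> 'I_m}) i).
pose boxG n c := \bigcap_(i in [set: 'I_k]) G n i @^-1` cell K ((c : {ffun 'I_k -> 'I_m}) i).
have mboxX c : measurable (boxX c).
  by apply: fin_bigcap_measurable => [|i _]; [exact: finite_finset|exact: (measurable_preimage _ _ _ (measurable_itv _))].
have mboxG n c : measurable (boxG n c).
  by apply: fin_bigcap_measurable => [|i _]; [exact: finite_finset|exact: (measurable_preimage _ _ _ (measurable_itv _))].
pose N := #|{ffun 'I_k -> 'I_m}|.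
have N0 : 0 < N.+1%:R :> R by rewrite ltr0n.
exists (K + m%:R * h).
have near_box : \forall n \near \oo, forall c, `|pr P1 (boxX c) - pr P2 (boxG n c)| <= e / 2 / N.+1%:R.
  apply: filter_forall => c.
  have : pr P2 (boxG n c) @[n --> \oo] --> pr P1 (boxX c).
    rewrite pr_box//; under eq_fun do rewrite pr_box//.
    apply: cvg_big => //; first exact: mul_continuous.
    by move=> i _; apply: cvgB; exact: cvgG.
  by move=> /cvgrPdist_le; apply; rewrite !divr_gt0.
near=> n => A B mA mB AB.
have nearc : forall c, `|pr P1 (boxX c) - pr P2 (boxG n c)| <= e / 2 / N.+1%:R by near: n.
pose good c := `[< exists2 w, A w & boxX c w >].
pose tail := \big[setU/set0]_(i < k) [set w | K <= `|X i w|].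
have mtaili i : measurable [set w | K <= `|X i w|].
  exact: measurable_abs_level.
have mtail : measurable tail by exact: bigsetU_measurable.
pose goods := [seq c <- enum {ffun 'I_k -> 'I_m} | good c].
have mgoods : measurable (\big[setU/set0]_(c <- goods) boxX c) by exact: bigsetU_measurable.
have cover : A `<=` tail `|` \big[setU/set0]_(c <- goods) boxX c.
  move=> w Aw.
  have [|ntail] := pselect (tail w); first by left.
  right.
  have Xlt i : `|X i w| < K.
    rewrite ltNge; apply/negP => Kle; apply: ntail.
    by rewrite /tail (bigD1 i)//=; left.
  pose q i := (X i w + K) / h.
  have q0 i : 0 < q i.
    by rewrite divr_gt0//; have := Xlt i; rewrite ltr_norml => /andP[]; lra.
  have : forall i, exists c : 'I_m, cell K c (X i w).
    move=> i.
    pose t := Num.truncn (q i).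
    have /truncn_itv/andP[t1 t2] : 0 <= q i by exact: ltW.
    (* Cells are closed on the right: a grid point belongs to the cell that ends there, whose index
       is one less than the integer part. *)
    have [tq|tq] := eqVneq (t%:R : R) (q i).
      have t0 : (0 < t)%N by rewrite -(ltr_nat R) tq.
      have tm : (t.-1 < m)%N.
        rewrite /m ltnS (leq_trans (leq_pred _))// le_truncn//.
        rewrite ler_wpM2r ?invr_ge0 ?(ltW h0)//.
        by have := Xlt i; rewrite ltr_norml => /andP[]; lra.
      exists (Ordinal tm); rewrite /cell /= in_itv/= prednK// tq.
      rewrite /q divfK ?gt_eqF// -ltrBrDl -lerBlDl opprK lexx andbT.
      rewrite -ltr_pdivlMr// -/(q i) -tq ltr_nat.
      by rewrite prednK.
    have tm : (t < m)%N.
      rewrite /m ltnS le_truncn//.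
      rewrite ler_wpM2r ?invr_ge0 ?(ltW h0)//.
      by have := Xlt i; rewrite ltr_norml => /andP[]; lra.
    exists (Ordinal tm); rewrite /cell /= in_itv/=.
    rewrite -ltrBrDl -lerBlDl opprK -ltr_pdivlMr// -ler_pdivrMr// -/(q i).
    by rewrite lt_neqAle tq t1 ltW.
  move=> /choice[c cP].
  rewrite (big_rem [ffun i => c i])/=; last first.
    rewrite mem_filter mem_enum andbT; apply/asboolP; exists w => // i _ /=.
    by rewrite ffunE.
  by left => i _ /=; rewrite ffunE.
have sum_tail : pr P1 tail <= e / 2.
  apply: (le_trans (pr_bigsetU_le _ _ _ _ mtaili)).
  apply: (@le_trans _ _ (\sum_(i < k) (e / 2 / k.+1%:R))).
    by apply: ler_sum => i _.
  rewrite sumr_const card_ord -[leLHS]mulr_natr -mulrA ler_piMr ?divr_ge0 ?(ltW e0)//.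
  by rewrite mulrC ler_pdivrMr// mul1r ler_nat.
have disj c c' : c != c' -> boxG n c `&` boxG n c' = set0.
  move=> cc'; apply/seteqP; split => // w [wc wc'].
  case/eqP: cc'; apply/ffunP => i; apply/val_inj => /=.
  have := wc i I; have := wc' i I; rewrite /cell /= !in_itv/= => /andP[a1 a2] /andP[b1 b2].
  have H (a b : nat) : - K + a%:R * h < - K + b.+1%:R * h -> (a <= b)%N.
    by rewrite ltrD2l ltr_pM2r// ltr_nat.
  by apply/eqP; rewrite eqn_leq; apply/andP; split; apply: H;
    [exact: lt_le_trans b1 a2|exact: lt_le_trans a1 b2].
have sub c : c \in goods -> boxG n c `<=` B.
  rewrite mem_filter => /andP[/asboolP[w Aw wc] _] w' wc'.
  apply: (AB w w' Aw) => i.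
    have := wc i I; have := wc' i I; rewrite /cell /= !in_itv/= => /andP[a1 a2] /andP[b1 b2].
    move: a1 a2 b1 b2; rewrite -natr1 mulrDl mul1r; set z := _ * h.
    by move=> *; rewrite ler_distl; apply/andP; split; lra.
  have := wc' i I; rewrite /cell /= !in_itv/= => /andP[a1 a2].
  have b1 : 0 <= (c i)%:R * h by rewrite mulr_ge0// ltW.
  have b2 : (c i).+1%:R * h <= m%:R * h by rewrite ler_wpM2r ?(ltW h0)// ler_nat ltn_ord.
  have b3 : 0 <= m%:R * h by rewrite mulr_ge0// ltW.
  by rewrite ler_norml; apply/andP; split; lra.
apply: (@le_trans _ _ (pr P1 tail + \sum_(c <- goods) pr P1 (boxX c))).
  apply: (@le_trans _ _ (pr P1 (tail `|` \big[setU/set0]_(c <- goods) boxX c))).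
    by apply: pr_le => //; exact: measurableU.
  apply: (le_trans (pr_setU_le _ _ _ _ _)) => //.
  by rewrite lerD2l pr_bigsetU_le.
have ugoods : uniq goods by rewrite filter_uniq// enum_uniq.
have step : \sum_(c <- goods) pr P1 (boxX c) <= pr P2 B + e / 2.
  apply: (@le_trans _ _ (\sum_(c <- goods) (pr P2 (boxG n c) + e / 2 / N.+1%:R))).
    apply: ler_sum => c _; have := nearc c; rewrite ler_distl => /andP[_].
    by [].
  rewrite big_split/= lerD//; first exact: pr_sum_disjoint_le.
  rewrite big_const_seq count_predT iter_addr_0 -[leLHS]mulr_natr -mulrA ler_piMr ?divr_ge0 ?(ltW e0)//.
  rewrite mulrC ler_pdivrMr// mul1r ler_nat.
  by rewrite (leq_trans _ (leqnSn _))// /N cardE size_filter count_size.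
by move: sum_tail step; lra.
Unshelve. all: by end_near. Qed.
End box_coupling.

(** * Race times and clearance times *)

Section race_time.
Context {R : realType} {k : nat}.
Variable p : 'I_k.+1 -> R.
Hypothesis p_gt0 : forall i, 0 < p i.
Implicit Types (x : 'rV[R]_k.+1) (g : 'I_k.+1 -> R).

(* The maximum has no neutral element in [R], so it starts from one of its own terms. *)
Definition race_time x g : R :=
  \big[Num.max/(x ord0 ord0 - g ord0) / p ord0]_(i < k.+1) ((x ord0 i - g i) / p i).

Lemma le_race_time x g i : x ord0 i <= g i + p i * race_time x g.
Proof.
rewrite -lerBlDl mulrC -ler_pdivrMr//.
exact: (le_bigmax _ (fun i => (x ord0 i - g i) / p i)).
Qed.

Lemma race_time_le x g t : (forall i, x ord0 i <= g i + p i * t) -> race_time x g <= t.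
Proof.
move=> h; have h' i : (x ord0 i - g i) / p i <= t.
  by rewrite ler_pdivrMr// mulrC lerBlDl.
exact: bigmax_le.
Qed.

Lemma race_time_gt x g t : t < race_time x g -> exists i, g i + p i * t < x ord0 i.
Proof.
move=> h; apply: contrapT => /forallNP H; move: h; apply/negP; rewrite -leNgt.
by apply: race_time_le => i; rewrite leNgt; apply/negP/H.
Qed.

Lemma race_time_near x x' g g' r :
  (forall i, `|(x ord0 i - g i) - (x' ord0 i - g' i)| <= p i * r) ->
  race_time x g <= race_time x' g' + r.
Proof.
move=> h; apply: race_time_le => i.
have := h i; have := le_race_time x' g' i.
rewrite ler_norml mulrDr => h1 /andP[_ h2]; lra.
Qed.

(** Summing [le_race_time] over the sides cancels the entries of [x], so the bound depends on [g]
    alone. It serves allocations of arbitrary size. *)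
Lemma race_time_ge_sum x g : \sum_(i < k.+1) p i = 1 -> \sum_(i < k.+1) x ord0 i = 0 ->
  - (\sum_(i < k.+1) g i) <= race_time x g.
Proof.
move=> p1 x0.
have : \sum_(i < k.+1) x ord0 i <= \sum_(i < k.+1) (g i + p i * race_time x g).
  by apply: ler_sum => i _; exact: le_race_time.
by rewrite big_split/= -mulr_suml p1 mul1r x0; lra.
Qed.
End race_time.

Lemma measurable_bigmaxe {R : realType} {d : measure_display} {T : measurableType d}
    (k : nat) (f : 'I_k -> T -> \bar R) :
  (forall i, measurable_fun setT (f i)) ->
  measurable_fun setT (fun w => \big[maxe/-oo%E]_(i < k) f i w).
Proof.
move=> mf; elim: (index_enum _) => [|i s IH].
  by under eq_fun do rewrite big_nil; exact: measurable_cst.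
by under eq_fun do rewrite big_cons; exact: measurable_maxe.
Qed.

Section clearance.
Context {R : realType} {k : nat} {d : measure_display} {T : measurableType d}.
Variables (P : probability T R) (p : 'I_k -> R) (Y : 'I_k -> R -> {RV P >-> nat}).
Hypothesis Y_poisson : forall i, poisson_process (p i) (Y i).

Lemma hitting_time_le i m w (t : R) : 0 <= t -> (m <= Y i t w)%N ->
  (hitting_time Y i m w <= t%:E)%E.
Proof. by move=> t0 mY; apply: ereal_inf_lbound; exists t. Qed.

(* The non-strict bound spares right continuity of the paths; [clearance_time_lt] makes up
   for it with two distinct times. *)
Lemma hitting_time_ge i m w (t : R) : 0 <= t -> (Y i t w < m)%N ->
  (t%:E <= hitting_time Y i m w)%E.
Proof.
move=> t0 Ym; apply: le_ereal_inf_tmp => _ [s [s0 ms] <-]; rewrite lee_fin leNgt.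
apply/negP => st; have := poisson_process_nd (Y_poisson i) w s0 (ltW st).
by move=> /(leq_trans ms); rewrite leqNgt Ym.
Qed.

Lemma measurable_count_ge i (t : R) m : measurable [set w | (m <= Y i t w)%N].
Proof.
rewrite (_ : [set w | _] = Y i t @^-1` [set j | (m <= j)%N])//.
by rewrite -[X in measurable X]setTI; exact: measurable_funPT.
Qed.

(** Paths are nondecreasing, so hitting before [r] is witnessed at a rational time before [r]; the
    event is a countable union. *)
Lemma measurable_hitting_time i m : measurable_fun setT (hitting_time Y i m).
Proof.
apply: (measurability _ (ErealGenInftyO.measurableE R)) => _ /= -[_ [r ->] <-].
rewrite setTI.
rewrite (_ : _ @^-1` _ = \bigcup_(q : rat)
    (if (0 <= (ratr q : R)) && ((ratr q : R) < r) then [set w | (m <= Y i (ratr q) w)%N]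
     else set0)).
  apply: bigcupT_measurable_rat => q; case: ifP => // _.
  exact: measurable_count_ge.
apply/seteqP; split => w /=; rewrite in_itv/=.
  move=> /ereal_inf_lt[_ [t [t0 mt] <-]]; rewrite lte_fin => tr.
  have [q] := rat_in_itvoo tr; rewrite in_itv/= => /andP[tq qr].
  exists q => //; rewrite qr (le_trans t0 (ltW tq))/=.
  exact: leq_trans mt (poisson_process_nd (Y_poisson i) w t0 (ltW tq)).
move=> [q _]; case: ifP => // /andP[q0 qr] /= mq.
by apply: (le_lt_trans (hitting_time_le _ _ _ _ q0 mq)); rewrite lte_fin.
Qed.

Lemma measurable_clearance_time xi : measurable_fun setT (clearance_time Y xi).
Proof. by apply: measurable_bigmaxe => i; exact: measurable_hitting_time. Qed.

Lemma clearance_time_lt xi xi' w (s t : R) : 0 <= s -> s < t ->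
  (forall i, (xi i <= Y i s w)%N) -> (exists i, (Y i t w < xi' i)%N) ->
  (clearance_time Y xi w < clearance_time Y xi' w)%E.
Proof.
move=> s0 st le_s [i lt_t]; apply: (@le_lt_trans _ _ s%:E).
  by apply: bigmax_le => [|j _]; [exact: leNye|exact: hitting_time_le].
apply: (@lt_le_trans _ _ t%:E); first by rewrite lte_fin.
apply: (le_trans (hitting_time_ge _ _ _ _ _ lt_t)); first by lra.
exact: (le_bigmax _ (fun i => hitting_time Y i (xi' i) w)).
Qed.

(** The times come in either order, since the time grid used later extends to both sides of [n]. *)
Lemma poisson_increment_chebyshev i (s t a : R) : 0 < p i -> 0 <= s -> 0 <= t -> 0 < a ->
  pr P [set w | a <= `|(Y i t w)%:R - (Y i s w)%:R - p i * (t - s)|]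
    <= p i * `|t - s| / a ^+ 2.
Proof.
move=> p0 + + a0.
have mA (s' t' : R) : measurable [set w | a <= `|(Y i t' w)%:R - (Y i s' w)%:R - p i * (t' - s')|].
  apply: (measurable_abs_level (fun w => (Y i t' w)%:R - (Y i s' w)%:R - p i * (t' - s'))).
  apply: measurable_funB; last exact: measurable_cst.
  by apply: measurable_funB; (apply: measurableT_comp => //).
have key s' t' : 0 <= s' -> s' < t' ->
    pr P [set w | a <= `|(Y i t' w)%:R - (Y i s' w)%:R - p i * (t' - s')|]
      <= p i * (t' - s') / a ^+ 2.
  move=> s0 st; rewrite -lee_fin -pr_EFin//.
  have l0 : 0 < p i * (t' - s') by rewrite mulr_gt0// subr_gt0.
  apply: le_trans (poisson_prob_chebyshev _ _ l0 a0).
  rewrite -(poisson_process_increment (Y_poisson i) s0 st).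
  rewrite (_ : [set w | _] = [set w | [set j : nat | (a <= `|j%:R - p i * (t' - s')|)%R] (Y i t' w - Y i s' w)%N])//.
  apply/seteqP; split => w /=; rewrite natrB//; exact: (poisson_process_nd (Y_poisson i) _ s0 (ltW st)).
move=> s0 t0; have [st|ts|<-] := ltgtP s t.
- by rewrite (ger0_norm (x := t - s)) ?subr_ge0 ?(ltW st)//; exact: key.
- rewrite distrC (ger0_norm (x := s - t)) ?subr_ge0 ?(ltW ts)//.
  apply: le_trans (key _ _ t0 ts); rewrite le_eqVlt; apply/orP; left; apply/eqP.
  congr pr; apply/seteqP; split => w /=; rewrite -normrN; congr (is_true (_ <= `|_|)); ring.
- rewrite subrr normr0 mulr0 mul0r (_ : [set w | _] = set0) ?pr_set0//.
  by apply/seteqP; split => // w /=; rewrite !subrr normr0; lra.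
Qed.
End clearance.

(** * The limiting noise *)

Section normal_extra.
Context {R : realType}.

Lemma normal_prob_itvcy (c : R) : normal_prob 0 1 `[c, +oo[ = (1 - normal_cdf c)%:E.
Proof.
have E : normal_prob 0 1 `]-oo, c[ = normal_prob 0 1 `]-oo, c] :> \bar R.
  rewrite /normal_prob integral_itv_bndo_bndc//.
  by apply/measurable_EFinP/measurable_funTS; exact: measurable_normal_pdf.
rewrite EFinB -normal_cdf_EFin -E -setCitvl probability_setC//.
Qed.

Lemma normal_cdf_lip (a b : R) : a <= b ->
  normal_cdf b - normal_cdf a <= normal_peak 1 * (b - a).
Proof.
move=> ab; suff : normal_cdf b - normal_peak 1 * b <= normal_cdf a - normal_peak 1 * a.
  by rewrite mulrBr; lra.
refine (@derive_sign_le _ (fun v => normal_cdf v - normal_peak 1 * v)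
  (fun v => normal_pdf 0 1 v - normal_peak 1) a b ab _ _) => v _.
  have h := is_deriveB (is_derive_normal_cdf v)
    (is_deriveZ (normal_peak 1) (is_derive_id v (1 : R))).
  by apply: is_derive_eq h _; rewrite /GRing.scale /= mulr1.
by rewrite subr_le0 normal_pdf_ub// oner_neq0.
Qed.
End normal_extra.

Lemma mutually_independent_coordinates {R : realType} {d : measure_display}
    {T : measurableType d} (P : probability T R) (k : nat)
    (F : 'I_k -> set (set T)) (X : 'I_k -> T -> R) :
  mutually_independent P F ->
  (forall i B, measurable B -> F i (X i @^-1` B)) ->
  independent_coordinates _ _ P X.
Proof.
move=> indF FX B mB.
have := indF (enum 'I_k) (fun i => X i @^-1` B i) (enum_uniq _).
rewrite big_enum /= => <-; last by move=> i _; exact: FX.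
congr (P _); apply/seteqP; split => w h i /= _; apply: h => //=.
by rewrite mem_enum.
Qed.

Section limit_noise.
Context {R : realType} {k : nat} {d : measure_display} {T : measurableType d}.
Variables (P : probability T R) (p : 'I_k -> R) (Z : 'I_k -> {RV P >-> R}).
Hypothesis p_gt0 : forall i, 0 < p i.
Hypothesis Z_normal : forall (i : 'I_k) (B : set R), measurable B ->
     distribution P (Z i) B = normal_prob 0 1 B.
Hypothesis Z_indep : mutually_independent P (fun i : 'I_k => sigma_of (Z i)).

(* The limit of the fluctuations of the [i]-th count.  A large count clears a side early,
   hence the sign. *)
Definition noise (i : 'I_k) (w : T) : R := - (Num.sqrt (p i) * Z i w).

Lemma measurable_noise i : measurable_fun setT (noise i).
Proof.
apply: measurableT_comp => //; apply: measurable_funM => //.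
Qed.

Lemma independent_noise : independent_coordinates _ _ P noise.
Proof.
apply: (mutually_independent_coordinates _ _ _ _ Z_indep) => i B mB.
exists ((fun z => - (Num.sqrt (p i) * z)) @^-1` B); last by rewrite setTI.
rewrite -[X in measurable X]setTI.
have : measurable_fun setT (fun z : R => - (Num.sqrt (p i) * z)).
  by apply: measurableT_comp => //; exact: measurable_funM.
exact.
Qed.

Lemma noise_cdf i b : pr P [set w | noise i w <= b] = 1 - normal_cdf (- b / Num.sqrt (p i)).
Proof.
have sp : 0 < Num.sqrt (p i) by rewrite sqrtr_gt0.
apply: EFin_inj; rewrite -normal_prob_itvcy -(Z_normal i)// -pr_EFin; last first.
  exact: (measurable_le_level _ (measurable_noise i)).
rewrite /distribution /pushforward; congr (P _); apply/seteqP; split => w /=.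
  rewrite in_itv/= andbT /noise ler_pdivrMr// mulrC; lra.
by rewrite in_itv/= andbT /noise ler_pdivrMr// mulrC; lra.
Qed.

Lemma noise_interval i (a b : R) : a <= b ->
  pr P (noise i @^-1` `]a, b]) <= normal_peak 1 / Num.sqrt (p i) * (b - a).
Proof.
move=> ab; have sp : 0 < Num.sqrt (p i) by rewrite sqrtr_gt0.
have mn := measurable_noise i.
rewrite (_ : noise i @^-1` `]a, b] = [set w | noise i w <= b] `\` [set w | noise i w <= a]); last first.
  apply/seteqP; split => w /=; rewrite in_itv/=.
    by move=> /andP[aw wb]; split=> //; apply/negP; rewrite -ltNge.
  by move=> [wb /negP]; rewrite -ltNge => ->.
have := pr_setDK P [set w | noise i w <= a] [set w | noise i w <= b]
  (measurable_le_level _ mn _) (measurable_le_level _ mn _).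
have sub : [set w | noise i w <= a] `<=` [set w | noise i w <= b].
  by move=> w /= /le_trans; apply.
move=> /(_ sub); rewrite !noise_cdf => h.
have ab' : - b / Num.sqrt (p i) <= - a / Num.sqrt (p i).
  by rewrite ler_pM2r ?invr_gt0// lerN2.
have := normal_cdf_lip _ _ ab'.
rewrite (_ : normal_peak 1 * _ = normal_peak 1 / Num.sqrt (p i) * (b - a)); last by ring.
by lra.
Qed.

(** On the event both sides of the equation fall in the same cell of a fine partition. Independence
    bounds its probability by a sum of products, in which the factor of [noise j] is small with the
    cell width because its density is bounded. Only the product rule on rectangles is used, and
    nothing is asked of the law of [f (noise i w)]. *)
Lemma noise_neq i j (f : R -> R) : i != j -> measurable_fun setT f ->
  pr P [set w | noise j w = f (noise i w)] = 0.
Proof.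
move=> ij mf.
pose g w := f (noise i w).
have mg : measurable_fun setT g by apply: measurableT_comp => //; exact: measurable_noise.
have mj := measurable_noise j.
have mE : measurable [set w | noise j w = g w].
  rewrite (_ : [set w | _] = (fun w => noise j w - g w) @^-1` [set 0]); last first.
    by apply/seteqP; split => w /= h; [rewrite h subrr|exact: subr0_eq].
  apply: measurable_preimage => //; exact: measurable_funB.
pose c := normal_peak 1 / Num.sqrt (p j).
have c0 : 0 <= c by rewrite divr_ge0// normal_peak_ge0.
have indep a b : pr P (g @^-1` `]a, b] `&` noise j @^-1` `]a, b]) =
    pr P (g @^-1` `]a, b]) * pr P (noise j @^-1` `]a, b]).
  have m1 : measurable (g @^-1` `]a, b]) by exact: measurable_preimage.
  have m2 : measurable (noise j @^-1` `]a, b]) by exact: measurable_preimage.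
  apply: EFin_inj; rewrite EFinM -!pr_EFin//; last exact: measurableI.
  pose B l : set R := if l == i then f @^-1` `]a, b] else if l == j then `]a, b]%classic else setT.
  have mB l : measurable (B l).
    rewrite /B; case: ifP => _; first exact: measurable_preimage.
    by case: ifP => _ //; exact: measurable_itv.
  have := independent_noise B mB.
  rewrite (bigD1 i)//= (bigD1 j)//=; last by rewrite eq_sym.
  rewrite big1 ?mule1; last first.
    move=> l /andP[/negbTE li /negbTE lj]; rewrite /B li lj preimage_setT.
    exact: probability_setT.
  rewrite {2 3}/B eqxx eq_sym (negbTE ij) eqxx => <-.
  congr (P _); apply/seteqP; split => w.
    by move=> [h1 h2] l _; rewrite /B; case: eqP => [->//|_]; case: eqP => [->//|].
  move=> h; split; first by have := h i I; rewrite /B eqxx.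
  by have := h j I; rewrite /B eq_sym (negbTE ij) eqxx.
apply/eqP; rewrite eq_le pr_ge0 andbT; apply/ler_addgt0Pr => e e0; rewrite add0r.
have e20 : 0 < e / 2 by rewrite divr_gt0.
near (+oo : set_system R) => K.
have K0 : 0 < K by near: K; exact: nbhs_pinfty_gt.
have tailK : pr P [set w | K <= `|g w|] <= e / 2 by near: K; exact: pr_abs_tail.
pose h := e / 2 / (c + 1).
have c1 : 0 < c + 1 by lra.
have h0 : 0 < h by rewrite divr_gt0.
pose m := (Num.truncn (2 * K / h)).+2.
(* The grid starts one step below [- K], so that a grid point gets the index [truncn q] itself and
   any other point its successor, with no predecessor of 0 to exclude. *)
pose a l := - K - h + l%:R * h : R.
pose cell (l : nat) : set R := `](a l), (a l.+1)]%classic.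
have acell l : a l.+1 - a l = h by rewrite /a -natr1; ring.
have mcell f' l : measurable_fun setT f' -> measurable ((f' : T -> R) @^-1` cell l).
  by move=> mf'; exact: (measurable_preimage _ mf' _ (measurable_itv _)).
have cover : [set w | noise j w = g w] `<=` [set w | K <= `|g w|] `|`
    \big[setU/set0]_(l < m) (g @^-1` cell l `&` noise j @^-1` cell l).
  move=> w /= nw; have [Kg|gK] := leP K `|g w|; [by left|right].
  pose q := (g w + K) / h.
  have q0 : 0 < q by rewrite divr_gt0//; move: gK; rewrite ltr_norml => /andP[]; lra.
  have /truncn_itv/andP[q1 q2] : 0 <= q by exact: ltW.
  have hq : q * h = g w + K by rewrite /q divfK// gt_eqF.
  suff [l lm lc] : exists2 l : nat, (l < m)%N & cell l (g w).
    by rewrite (bigD1 (Ordinal lm))//=; left; split => //=; rewrite nw.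
  have [tq|tq] := eqVneq ((Num.truncn q)%:R : R) q.
    exists (Num.truncn q).
      rewrite /m ltnS leqW// le_truncn// ler_wpM2r ?invr_ge0 ?(ltW h0)//.
      by move: gK; rewrite ltr_norml => /andP[]; lra.
    by rewrite /cell /= in_itv/= /a -natr1 tq mulrDl hq mul1r; apply/andP; split; lra.
  exists (Num.truncn q).+1.
    rewrite /m ltnS ltnS le_truncn// ler_wpM2r ?invr_ge0 ?(ltW h0)//.
    by move: gK; rewrite ltr_norml => /andP[]; lra.
  have q3 : (Num.truncn q)%:R < q by rewrite lt_neqAle tq.
  have q4 : (Num.truncn q)%:R * h < q * h by rewrite ltr_pM2r.
  have q5 : q * h < (Num.truncn q).+1%:R * h by rewrite ltr_pM2r.
  rewrite /cell /= in_itv/= /a -natr1 -[_.+2%:R]natr1 -natr1 !mulrDl !mul1r.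
  by move: q4 q5; rewrite hq -natr1 mulrDl mul1r => q4 q5; apply/andP; split; lra.
apply: (le_trans (pr_le _ _ _ _ _ cover)) => //.
  apply: measurableU; first exact: measurable_abs_level.
  by apply: bigsetU_measurable => l _; apply: measurableI; exact: mcell.
apply: (le_trans (pr_setU_le _ _ _ _ _)).
- exact: measurable_abs_level.
- by apply: bigsetU_measurable => l _; apply: measurableI; exact: mcell.
suff : pr P (\big[setU/set0]_(l < m) (g @^-1` cell l `&` noise j @^-1` cell l)) <= e / 2.
  by move: tailK; lra.
apply: (le_trans (pr_bigsetU_le _ _ _ _ _)).
  by move=> l; apply: measurableI; exact: mcell.
apply: (@le_trans _ _ (\sum_(l < m) pr P (g @^-1` cell l) * (e / 2))).
  apply: ler_sum => l _; rewrite indep ler_wpM2l ?pr_ge0//.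
  apply: (le_trans (noise_interval _ _ _ _)); first by have := acell l; lra.
  rewrite acell -/c /h mulrCA ler_piMr ?(ltW e20)// ler_pdivrMr// mul1r; lra.
rewrite -mulr_suml ler_piMl ?(ltW e20)//.
apply: (@le_trans _ _ (pr P setT)); last by rewrite pr_le1.
have -> : \sum_(l < m) pr P (g @^-1` cell l) = \sum_(l <- index_enum 'I_m) pr P (g @^-1` cell l) by [].
apply: pr_sum_disjoint_le => //.
- by move=> l; exact: mcell.
- exact: index_enum_uniq.
move=> l l' ll'; apply/seteqP; split => // w [wl wl'].
case/eqP: ll'; apply/val_inj => /=.
move: wl wl'; rewrite /cell /= !in_itv/= => /andP[a1 a2] /andP[b1 b2].
have H (u v : nat) : a u < a v.+1 -> (u <= v)%N.
  by rewrite ltrD2l ltr_pM2r// ltr_nat.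
by apply/eqP; rewrite eqn_leq; apply/andP; split; apply: H;
  [exact: lt_le_trans a1 b2|exact: lt_le_trans b1 a2].
Unshelve. all: by end_near. Qed.
End limit_noise.

(** * Coupling the two games *)

Lemma measurable_race_time {R : realType} {k : nat} {d : measure_display}
    {T : measurableType d} (p : 'I_k.+1 -> R) (X : 'I_k.+1 -> T -> R) (x : 'rV[R]_k.+1) :
  (forall i, measurable_fun setT (X i)) ->
  measurable_fun setT (fun w => race_time p x (X ^~ w)).
Proof.
move=> mX; rewrite /race_time.
have m i : measurable_fun setT (fun w => (x ord0 i - X i w) / p i).
  by apply: measurable_funM => //; exact: measurable_funB.
elim: (index_enum _) => [|i s IH].
  by under eq_fun do rewrite big_nil; exact: m.
by under eq_fun do rewrite big_cons; exact: measurable_maxr.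
Qed.

Lemma normalized_allocation_sum0 {R : realType} {k : nat} (p : 'I_k -> R) n :
  \sum_(i < k) p i = 1 -> normalized_allocation p n `<=` allocation.
Proof.
move=> p1 _ [xi xin <-]; rewrite /allocation /=.
under eq_bigr do rewrite mxE.
by rewrite -mulr_suml sumrB -natr_sum xin -mulr_suml p1 mul1r subrr mul0r.
Qed.

(** Meant for a count [W] at a grid time with prediction [c + u * s] and error below [v * s],
    compared with the token number [c + x * s], where [s] is the square root of [n]. *)
Lemma count_lower {R : realType} (W c u v s x : R) : 0 <= s ->
  `|W - (c + u * s)| < v * s -> x <= u - v -> c + x * s <= W.
Proof.
move=> s0; rewrite ltr_norml => /andP[h _] xu.
have := ler_wpM2r s0 xu; rewrite mulrBl; lra.
Qed.

Lemma count_upper {R : realType} (W c u v s y : R) : 0 < s ->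
  `|W - (c + u * s)| < v * s -> u + v < y -> W < c + y * s.
Proof.
move=> s0; rewrite ltr_norml => /andP[_ h] uy.
have : (u + v) * s < y * s by rewrite ltr_pM2r.
rewrite mulrDl; lra.
Qed.

Section game_coupling.
Context {R : realType} {k : nat}.
Context {d1 d2 : measure_display} {T1 : measurableType d1} {T2 : measurableType d2}.
Variables (p : 'I_k.+1 -> R) (P1 : probability T1 R) (Z : 'I_k.+1 -> {RV P1 >-> R}).
Variables (P2 : probability T2 R) (Y : 'I_k.+1 -> R -> {RV P2 >-> nat}).
Hypothesis p_gt0 : forall i, 0 < p i.
Hypothesis p_sum1 : \sum_(i < k.+1) p i = 1.
Hypothesis Z_normal : forall (i : 'I_k.+1) (B : set R), measurable B ->
     distribution P1 (Z i) B = normal_prob 0 1 B.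
Hypothesis Z_indep : mutually_independent P1 (fun i : 'I_k.+1 => sigma_of (Z i)).
Hypothesis Y_poisson : forall i : 'I_k.+1, poisson_process (p i) (Y i).
Hypothesis Y_indep :
  mutually_independent P2 (fun i : 'I_k.+1 => sigma_of_process (Y i)).

Let X := noise P1 p Z.

Definition fluctuation (n : nat) (i : 'I_k.+1) (w : T2) : R :=
  ((Y i n%:R w)%:R - p i * n%:R) / Num.sqrt n%:R.

Lemma measurable_natr_count i (t : R) : measurable_fun setT (fun w => (Y i t w)%:R : R).
Proof. by apply: measurableT_comp => //. Qed.

Lemma measurable_fluctuation n i : measurable_fun setT (fluctuation n i).
Proof.
apply: measurable_funM => //; apply: measurable_funB => //.
exact: measurable_natr_count.
Qed.

Lemma independent_fluctuation n : independent_coordinates _ _ P2 (fluctuation n).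
Proof.
apply: (mutually_independent_coordinates _ _ _ _ Y_indep) => i B mB.
apply: sub_sigma_algebra; exists n%:R => /=; first exact: ler0n.
exists [set j : nat | B ((j%:R - p i * n%:R) / Num.sqrt n%:R)] => //.
by rewrite setTI.
Qed.

Lemma fluctuation_cvg i b :
  pr P2 [set w | fluctuation n i w <= b] @[n --> \oo] --> pr P1 [set w | X i w <= b].
Proof.
rewrite noise_cdf//.
have := poisson_clt (p i) b (p_gt0 i); apply: cvg_trans.
apply: near_eq_cvg; near=> n.
have n0 : (0 < n)%N by near: n; exists 1%N.
have n0R : (0 : R) < n%:R by rewrite ltr0n.
have := poisson_process_increment (Y_poisson i) (lexx 0) n0R
  [set j : nat | (j%:R <= p i * n%:R + b * Num.sqrt n%:R)%R].
rewrite subr0 => <-; congr fine; congr (P2 _).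
apply/seteqP; split => w /=; rewrite (poisson_process0 (Y_poisson i)) subn0 /fluctuation;
  rewrite ler_pdivrMr ?sqrtr_gt0//; lra.
Unshelve. all: by end_near. Qed.

Definition time_at (n : nat) (t : R) : R := n%:R + t * Num.sqrt n%:R.

(** Over a time [t * sqrt n] the variance is of order [sqrt n], whereas the tolerated squared error
    is of order [n]. Chebyshev's bound is thus [O(1 / sqrt n)] and survives a union over finitely
    many times and sides. *)
Lemma small_increments (ts : seq R) (a e : R) : 0 < a -> 0 < e ->
  \forall n \near \oo, (forall t, t \in ts -> 0 <= time_at n t) /\
  exists Om : set T2, [/\ measurable Om, pr P2 (~` Om) <= e &
    forall w, Om w -> forall i t, t \in ts ->
      `|(Y i (time_at n t) w)%:R - (Y i n%:R w)%:R - p i * (t * Num.sqrt n%:R)|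
        < a * Num.sqrt n%:R].
Proof.
move=> a0 e0.
pose S := \sum_(t <- ts) \sum_(i < k.+1) p i * `|t| / a ^+ 2.
pose U := \sum_(t <- ts) `|t|.
have tU t : t \in ts -> `|t| <= U.
  by move=> tts; rewrite /U (big_rem t)//= lerDl sumr_ge0.
have n1 : \forall n \near \oo, S * (Num.sqrt n%:R)^-1 < e.
  have h : S * (Num.sqrt n%:R)^-1 @[n --> \oo] --> (0 : R).
    by rewrite -(mulr0 S); apply: cvgMr; exact: cvg_inv_sqrtn.
  exact: (cvgr_lt _ h).
have n2 : \forall n \near \oo, U * (Num.sqrt n%:R)^-1 < 1.
  have h : U * (Num.sqrt n%:R)^-1 @[n --> \oo] --> (0 : R).
    by rewrite -(mulr0 U); apply: cvgMr; exact: cvg_inv_sqrtn.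
  exact: (cvgr_lt _ h).
near=> n.
have n0 : (0 < n)%N by near: n; exists 1%N.
have Un : U * (Num.sqrt n%:R)^-1 < 1 by near: n.
have Sn : S * (Num.sqrt n%:R)^-1 < e by near: n.
pose s : R := Num.sqrt n%:R.
have s0 : 0 < s by rewrite sqrtr_gt0 ltr0n.
have ss : n%:R = s * s by rewrite -expr2 sqr_sqrtr.
have tn t : t \in ts -> 0 <= time_at n t.
  move=> /tU tU'; rewrite /time_at -/s ss -mulrDl mulr_ge0 ?(ltW s0)//.
  move: Un; rewrite -/s ltr_pdivrMr// mul1r => Us.
  by move: tU'; rewrite ler_norml => /andP[h _]; lra.
split => //.
pose bad t i := [set w | a * s <= `|(Y i (time_at n t) w)%:R - (Y i n%:R w)%:R - p i * (t * s)|].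
have mbad t i : measurable (bad t i).
  apply: (measurable_abs_level (fun w => (Y i (time_at n t) w)%:R - (Y i n%:R w)%:R - p i * (t * s))).
  apply: measurable_funB => //.
  by apply: measurable_funB; exact: measurable_natr_count.
pose Bad := \big[setU/set0]_(t <- ts) \big[setU/set0]_(i < k.+1) bad t i.
have mBadt t : measurable (\big[setU/set0]_(i < k.+1) bad t i).
  exact: bigsetU_measurable.
have mBad : measurable Bad by exact: bigsetU_measurable.
exists (~` Bad); split; first exact: measurableC.
  rewrite setCK; apply: (@le_trans _ _ (S * s^-1)); last exact: ltW.
  apply: (le_trans (pr_bigsetU_le _ _ _ _ mBadt)).
  rewrite /S mulr_suml big_seq [leRHS]big_seq; apply: ler_sum => t tts.
  apply: (le_trans (pr_bigsetU_le _ _ _ _ (mbad t))).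
  rewrite mulr_suml; apply: ler_sum => i _.
  have as0 : 0 < a * s by rewrite mulr_gt0.
  have := poisson_increment_chebyshev _ _ _ Y_poisson i n%:R (time_at n t) (a * s)
    (p_gt0 i) (ler0n _ _) (tn t tts) as0.
  have -> : time_at n t - n%:R = t * s by rewrite /time_at addrC addKr.
  move=> /le_trans; apply; rewrite le_eqVlt; apply/orP; left; apply/eqP.
  by rewrite normrM (ger0_norm (ltW s0)); field; rewrite !gt_eqF.
move=> w nb i t tts; rewrite ltNge; apply/negP => h; apply: nb.
rewrite /Bad (big_rem t)//=; left; rewrite (bigD1 i)//=; left; exact: h.
Unshelve. all: by end_near. Qed.

Lemma min_rate : exists2 pm, 0 < pm & forall i, pm <= p i.
Proof.
exists (\big[Num.min/1]_(i < k.+1) p i).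
  by apply: lt_bigmin => // i _.
by move=> i; exact: bigmin_le_cond.
Qed.

(** If [a] lies so low that the quotient is negative, [truncn] returns 0 and the grid points 1 and 2
    are taken; the hypothesis [- L + 3 * h < b] covers this case. *)
Let grid_point (h L a b : R) (J : nat) : 0 < h ->
  (Num.truncn ((a + h + L) / h) < J)%N -> a + 5 * h < b -> - L + 3 * h < b ->
  exists j, [/\ (j <= J)%N, a + h <= - L + j%:R * h & - L + j.+1%:R * h + h < b].
Proof.
move=> h0 J1 ab Lb.
pose q := (a + h + L) / h.
have hq : q * h = a + h + L by rewrite /q divfK// gt_eqF.
exists (Num.truncn q).+1; split => //.
  have : q * h < (Num.truncn q).+1%:R * h by rewrite ltr_pM2r// truncnS_gt.
  by rewrite hq; lra.
rewrite -natr1 -natr1 !mulrDl mul1r.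
have [q0|q0] := leP 0 q.
  have /truncn_itv/andP[q1 _] := q0.
  have : (Num.truncn q)%:R * h <= q * h by rewrite ler_wpM2r// ltW.
  by rewrite hq; lra.
have -> : Num.truncn q = 0%N by apply/eqP; rewrite -leqn0 leqNgt truncn_gt0 -ltNge; lra.
by rewrite mul0r; lra.
Qed.

(** Only [x] is bounded. The finite time grid must reach above the race time of [x], which needs
    that bound, and start below the race time of [y], for which [race_time_ge_sum] provides a level
    common to all [y]. *)
Lemma race_coupling (delta e M : R) : 0 < delta -> 0 < e -> 0 <= M ->
  \forall n \near \oo, forall x y : 'rV[R]_k.+1,
    normalized_allocation p n x -> normalized_allocation p n y ->
    (forall i, `|x ord0 i| <= M) ->
    pr P1 [set w | race_time p x (X ^~ w) + delta < race_time p y (X ^~ w)] <=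
    pr P2 [set w | (clearance_time Y (tokens p n x) w < clearance_time Y (tokens p n y) w)%E] + e.
Proof.
move=> delta0 e0 M0.
have [pm pm0 pmP] := min_rate.
(* Exchanging the noise costs [h] for each of the two race times; the remaining gap [5 * h] is what
   [grid_point] asks for. *)
pose h := delta / 7.
have h0 : 0 < h by rewrite divr_gt0.
have e20 : 0 < e / 2 by rewrite divr_gt0.
have [C CP] := box_coupling P1 P2 X fluctuation (measurable_noise _ _ _)
  measurable_fluctuation (independent_noise _ _ _ Z_indep) independent_fluctuation
  fluctuation_cvg (pm * h) (mulr_gt0 pm0 h0) (e / 2) e20.
(* When fluctuations are at most [C], [L0] bounds the race time of [x] from above, and [- L] lies
   below every race time by more than [3 * h]. *)
pose L0 := (M + `|C|) / pm.
pose L := L0 + k.+1%:R * `|C| + 5 * h.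
have L00 : 0 <= L0 by rewrite divr_ge0 ?addr_ge0// ltW.
have kC : 0 <= k.+1%:R * `|C| by rewrite mulr_ge0.
pose J := (Num.truncn ((L0 + h + L) / h)).+1.
pose ts := [seq - L + j%:R * h | j <- iota 0 J.+2].
have incr := small_increments ts (pm * h) (e / 2) (mulr_gt0 pm0 h0) e20.
near=> n => x y Ax Ay xM.
have n0 : (0 < n)%N by near: n; exists 1%N.
have [tn [Om [mOm OmP inc]]] : (forall t, t \in ts -> 0 <= time_at n t) /\
  exists Om : set T2, [/\ measurable Om, pr P2 (~` Om) <= e / 2 &
    forall w, Om w -> forall i t, t \in ts ->
      `|(Y i (time_at n t) w)%:R - (Y i n%:R w)%:R - p i * (t * Num.sqrt n%:R)|
        < pm * h * Num.sqrt n%:R] by near: n.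
pose s : R := Num.sqrt n%:R.
have s0 : 0 < s by rewrite sqrtr_gt0 ltr0n.
set A := [set w | race_time p x _ + _ < _].
set B := [set w | (_ < _)%E].
have mX i : measurable_fun setT (X i) by exact: measurable_noise.
have mB : measurable B.
  rewrite -[X in measurable X]setTI; apply: measurable_lte => //;
  exact: (measurable_clearance_time _ _ _ Y_poisson).
have mrace z : measurable_fun setT (fun w => race_time p z (X ^~ w)).
  exact: measurable_race_time.
have mA : measurable A.
  rewrite (_ : A = ~` [set w | 0 <= race_time p x (X ^~ w) + delta - race_time p y (X ^~ w)]).
    apply: measurableC; apply: (measurable_ge_level (fun w => _)).
    by apply: measurable_funB => //; exact: measurable_funD.
  by apply/seteqP; split => w; rewrite /A /= => /negP; rewrite ?negbK -?ltNge; lra.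
have sumy : \sum_(i < k.+1) y ord0 i = 0 by exact: (normalized_allocation_sum0 p n p_sum1).
have tok z : normalized_allocation p n z -> forall i,
    ((tokens p n z i)%:R : R) = p i * n%:R + z ord0 i * s.
  by move=> [xi _ <-] i; rewrite normalizeK// mxE divfK ?gt_eqF//; ring.
(* On [Om] every count on the time grid is, up to [pm * h] after rescaling, its value at
   time [n] plus its mean increment, so both clearance times are located on the grid up to
   [h] by the race times of the fluctuations. *)
suff : pr P1 A <= pr P2 (B `|` ~` Om) + e / 2.
  move=> /le_trans; apply.
  have := pr_setU_le P2 B (~` Om) mB (measurableC mOm); move: OmP; lra.
have CPn : forall (A : set T1) (B : set T2), measurable A -> measurable B ->
  (forall w w', A w -> (forall i, `|X i w - fluctuation n i w'| <= pm * h) ->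
     (forall i, `|fluctuation n i w'| <= C) -> B w') ->
  pr P1 A <= pr P2 B + e / 2 by near: n.
apply: CPn => //; first by apply: measurableU => //; exact: measurableC.
move=> w w' Aw XG GC.
have [Omw|] := pselect (Om w'); last by right.
left; rewrite /B /=.
pose g := fluctuation n ^~ w'.
have near_race z : `|race_time p z (X ^~ w) - race_time p z g| <= h.
  have b1 : race_time p z (X ^~ w) <= race_time p z g + h.
    apply: race_time_near => // i.
    rewrite (_ : _ - _ = - (X i w - g i)) ?normrN; last by ring.
    by apply: (le_trans (XG i)); rewrite ler_wpM2r// ltW.
  have b2 : race_time p z g <= race_time p z (X ^~ w) + h.
    apply: race_time_near => // i.
    rewrite (_ : _ - _ = X i w - g i); last by ring.
    by apply: (le_trans (XG i)); rewrite ler_wpM2r// ltW.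
  by rewrite ler_distl; apply/andP; move: b1 b2; split; lra.
have ab : race_time p x g + 5 * h < race_time p y g.
  have := near_race x; have := near_race y; rewrite !ler_distl => /andP[y1 y2] /andP[x1 x2].
  move: Aw; rewrite /A /= /h; move: y2 x1; rewrite /h; lra.
have GC' i : `|g i| <= `|C| by apply: (le_trans (GC i)); exact: ler_norm.
have aL : race_time p x g <= L0.
  apply: race_time_le => // i.
  have pL : M + `|C| <= p i * L0.
    rewrite /L0 mulrCA ler_peMr ?addr_ge0// ler_pdivlMr// mul1r; exact: pmP.
  have := xM i; have := GC' i; rewrite !ler_norml => /andP[g1 _] /andP[_ x1]; move: g1 x1 pL; lra.
have bL : - L + 3 * h < race_time p y g.
  apply: (@lt_le_trans _ _ (- (\sum_(i < k.+1) g i))); last exact: race_time_ge_sum.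
  have : \sum_(i < k.+1) g i <= \sum_(i < k.+1) `|C|.
    by apply: ler_sum => i _; apply: le_trans (GC' i); exact: ler_norm.
  rewrite sumr_const card_ord -[X in _ <= X]mulr_natl /L; move: L00 h0; lra.
have [j [jJ aj jb]] : exists j, [/\ (j <= J)%N, race_time p x g + h <= - L + j%:R * h &
    - L + j.+1%:R * h + h < race_time p y g].
  apply: grid_point => //; rewrite /J ltnS le_truncn// ler_wpM2r ?invr_ge0 ?(ltW h0)//; move: aL; lra.
have ints l : (l <= J.+1)%N -> - L + l%:R * h \in ts.
  by move=> lJ; apply/mapP; exists l => //; rewrite mem_iota/= add0n ltnS.
have jts : - L + j%:R * h \in ts by apply: ints; exact: leqW.
have j1ts : - L + j.+1%:R * h \in ts by exact: ints.
have count i t : t \in ts ->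
    `|(Y i (time_at n t) w')%:R - (p i * n%:R + (g i + p i * t) * s)| < p i * h * s.
  move=> tts; have gE : g i * s = (Y i n%:R w')%:R - p i * n%:R.
    by rewrite /g /fluctuation divfK// gt_eqF.
  rewrite mulrDl gE -mulrA; apply: lt_le_trans (_ : pm * h * s <= _); last first.
    by rewrite !ler_wpM2r ?(ltW h0) ?(ltW s0).
  rewrite (_ : _ - _ = (Y i (time_at n t) w')%:R - (Y i n%:R w')%:R - p i * (t * s)); last by ring.
  exact: inc.
apply: (clearance_time_lt _ _ _ Y_poisson _ _ _ (time_at n (- L + j%:R * h))
   (time_at n (- L + j.+1%:R * h))).
- exact: tn.
- by rewrite /time_at ltrD2l ltr_pM2r// ltrD2l ltr_pM2r// ltr_nat.
- move=> i; rewrite -(ler_nat R) tok//.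
  apply: (count_lower _ _ _ _ _ _ (ltW s0) (count i _ jts)).
  rewrite -addrA -mulrBr (le_trans (le_race_time p p_gt0 x g i))// lerD2l.
  by rewrite ler_wpM2l ?(ltW (p_gt0 i))// lerBrDr.
- have [i iy] := race_time_gt p p_gt0 _ _ _ jb.
  exists i; rewrite -(ltr_nat R) tok//.
  apply: (count_upper _ _ _ _ _ _ s0 (count i _ j1ts)).
  by rewrite -addrA -mulrDr.
Unshelve. all: by end_near. Qed.
End game_coupling.

(** * Expectations and continuous test functions *)

Section expectation.
Context {d : measure_display} {T : measurableType d} {R : realType}.
Variable Q : probability T R.

Definition mean (f : T -> R) : R := \int[Q]_x f x.

Lemma integrable_of_bounded (f : T -> R) (c : R) : measurable_fun setT f ->
  (forall x, `|f x| <= c) -> Q.-integrable setT (EFin \o f).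
Proof.
move=> mf fc; apply: measurable_bounded_integrable => //.
  by rewrite (le_lt_trans (probability_le1 _ _))// ltry.
exists c; split; first exact: num_real.
by move=> M cM x _ /=; apply: le_trans (fc x) (ltW cM).
Qed.

Lemma mean_EFin (f : T -> R) (c : R) : measurable_fun setT f ->
  (forall x, `|f x| <= c) -> (\int[Q]_x (f x)%:E)%E = (mean f)%:E.
Proof.
move=> mf fc; rewrite /mean /Rintegral fineK//.
by apply: integrable_fin_num => //; exact: (integrable_of_bounded _ _ mf fc).
Qed.

Lemma mean_le (f g : T -> R) (c : R) : measurable_fun setT f -> measurable_fun setT g ->
  (forall x, `|f x| <= c) -> (forall x, `|g x| <= c) -> (forall x, f x <= g x) ->
  mean f <= mean g.
Proof.
move=> mf mg fc gc fg; apply: le_Rintegral => //.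
- exact: (integrable_of_bounded _ _ mf fc).
- exact: (integrable_of_bounded _ _ mg gc).
Qed.

Lemma mean_cst (c : R) : mean (fun=> c) = c.
Proof.
by rewrite /mean /Rintegral integral_cst// [X in (_ * X)%E]probability_setT mule1.
Qed.

Lemma meanB (f g : T -> R) (c : R) : measurable_fun setT f -> measurable_fun setT g ->
  (forall x, `|f x| <= c) -> (forall x, `|g x| <= c) ->
  mean (fun x => f x - g x) = mean f - mean g.
Proof.
move=> mf mg fc gc; rewrite /mean RintegralB//.
- exact: (integrable_of_bounded _ _ mf fc).
- exact: (integrable_of_bounded _ _ mg gc).
Qed.

Lemma mean_itv (f : T -> R) : measurable_fun setT f -> (forall x, 0 <= f x <= 1) ->
  0 <= mean f <= 1.
Proof.
move=> mf f01.
have fc x : `|f x| <= 1 by have /andP[f0 f1] := f01 x; rewrite ger0_norm.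
apply/andP; split; [rewrite -(mean_cst 0)|rewrite -[leRHS](mean_cst 1)];
  apply: (mean_le _ _ 1) => // x; rewrite ?normr0 ?normr1//; by case/andP: (f01 x).
Qed.

Lemma mean_cvg (f_ : nat -> T -> R) (f : T -> R) (c : R) :
  (forall n, measurable_fun setT (f_ n)) -> (forall n x, `|f_ n x| <= c) ->
  (forall x, f_ n x @[n --> \oo] --> f x) -> mean (f_ n) @[n --> \oo] --> mean f.
Proof.
move=> mf fc ff.
have mfl : measurable_fun setT f by apply: (measurable_fun_cvg mf) => x _; exact: ff.
have h : (\int[Q]_x (f_ n x)%:E)%E @[n --> \oo] --> (\int[Q]_x (f x)%:E)%E.
  apply: (dominated_cvg _ _ _ _ _ _ (g := fun=> c%:E)) => //.
  - by move=> n; exact/measurable_EFinP.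
  - by move=> x _; apply: cvg_EFin; [exact: nearW|exact: ff].
  - apply: (integrable_of_bounded (fun=> c) `|c|) => //.
  - by move=> n x _; rewrite /= lee_fin.
apply: fine_cvg; rewrite -/(Rintegral _ _ _) /mean.
rewrite fineK; first exact: h.
apply: integrable_fin_num => //; apply: (integrable_of_bounded _ c) => // x.
have fn : `|f_ n x| @[n --> \oo] --> `|f x| by apply: cvg_norm; exact: ff.
by rewrite -(cvg_lim _ fn)//; apply: limr_le; [exact: (cvgP _ fn)|exact: nearW].
Qed.

Lemma mean_indic (A : set T) : measurable A -> mean \1_A = pr Q A.
Proof. by move=> mA; rewrite /mean /Rintegral integral_indic// setIT. Qed.
End expectation.

Section clamp.
Context {R : realType}.
Implicit Types a b : R.

Definition clamp a : R := Num.max 0 (Num.min 1 a).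

Lemma clamp_itv a : 0 <= clamp a <= 1.
Proof. by rewrite /clamp le_max lexx/= ge_max ler01 ge_min lexx. Qed.

Lemma clamp_le0 a : a <= 0 -> clamp a = 0.
Proof. by move=> a0; apply/max_idPl; rewrite ge_min a0 orbT. Qed.

Lemma clamp_ge1 a : 1 <= a -> clamp a = 1.
Proof. by move=> a1; rewrite /clamp (min_idPl a1); apply/max_idPr. Qed.

Lemma clamp_id a : 0 <= a -> a <= 1 -> clamp a = a.
Proof. by move=> a0 a1; rewrite /clamp (min_idPr a1); apply/max_idPr. Qed.

Lemma clamp_lip a b : `|clamp a - clamp b| <= `|a - b|.
Proof.
wlog ab : a b / a <= b.
  move=> h; have [|/ltW] := leP a b; first exact: h.
  by rewrite distrC (distrC a); exact: h.
rewrite distrC (distrC a) (ger0_norm (x := b - a)) ?subr_ge0//.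
have [a0|a0] := leP a 0.
  rewrite (clamp_le0 a a0) subr0; have [b0|b0] := leP b 0.
    by rewrite clamp_le0// normr0; lra.
  have [b1|b1] := leP b 1; first by rewrite clamp_id ?(ltW b0)// gtr0_norm//; lra.
  by rewrite clamp_ge1 ?(ltW b1)// normr1; lra.
have [a1|a1] := leP a 1; last first.
  by rewrite !clamp_ge1 ?subrr ?normr0; lra.
rewrite (clamp_id a) ?(ltW a0)//; have [b1|b1] := leP b 1.
  by rewrite clamp_id// ?ger0_norm; lra.
by rewrite clamp_ge1 ?(ltW b1)// ger0_norm; lra.
Qed.

Lemma clamp_norm a : `|clamp a| <= 1.
Proof. by have /andP[h0 h1] := clamp_itv a; rewrite ger0_norm. Qed.

Lemma measurable_clamp {d : measure_display} {T : measurableType d} (f : T -> R) :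
  measurable_fun setT f -> measurable_fun setT (fun x => clamp (f x)).
Proof.
move=> mf; apply: measurable_maxr; first exact: measurable_cst.
by apply: measurable_minr => //; exact: measurable_cst.
Qed.
End clamp.

Section euclidean.
Context {R : realType} {k : nat}.
Local Notation E := (borel_rV R k.+1).
Implicit Types x y : 'rV[R]_k.+1.

Lemma measurable_open (U : set 'rV[R]_k.+1) : open U -> measurable (U : set E).
Proof. by move=> oU; apply: sub_sigma_algebra. Qed.

Lemma measurable_closed (U : set 'rV[R]_k.+1) : closed U -> measurable (U : set E).
Proof.
move=> cU; rewrite -[U]setCK; apply: measurableC; apply: measurable_open.
exact: closed_openC.
Qed.

Lemma continuous_measurable_rV (f : 'rV[R]_k.+1 -> R) : continuous f ->
  measurable_fun setT (f : E -> R).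
Proof.
move=> cf; apply: (measurability _ (RGenOpens.measurableE R)) => _ /= -[U oU <-].
rewrite setTI; apply: measurable_open.
case: oU => [a [b ->]].
by move/continuousP : cf; apply; exact: interval_open.
Qed.

Lemma entry_le_norm x i : `|x ord0 i| <= `|x|.
Proof.
rewrite [leRHS]/Num.norm /= mx_normrE.
exact: (le_bigmax _ (fun ij : 'I_1 * 'I_k.+1 => `|x ij.1 ij.2|) (ord0, i)).
Qed.

Lemma lipschitz_continuous_rV (f : 'rV[R]_k.+1 -> R) (c : R) :
  (forall x y, `|f x - f y| <= c * `|x - y|) -> continuous f.
Proof.
move=> lip x A /nbhs_normP[e /= e0 eA].
have c0 : 0 < `|c| + 1 by rewrite ltr_pwDr.
suff : nbhs (x : 'rV[R]_k.+1) (f @^-1` A) by [].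
apply/(@nbhs_normP _ 'rV[R]_k.+1); exists (e / (`|c| + 1)) => /=; first by rewrite divr_gt0.
move=> y /= xy; apply: eA => /=.
apply: (le_lt_trans (lip x y)).
apply: (@le_lt_trans _ _ ((`|c| + 1) * `|x - y|)).
  by rewrite ler_wpM2r// (le_trans (ler_norm c))// lerDl.
by rewrite mulrC -ltr_pdivlMr.
Qed.

Lemma continuous_entry (i : 'I_k.+1) : continuous (fun x : 'rV[R]_k.+1 => x ord0 i).
Proof.
apply: (lipschitz_continuous_rV _ 1) => x y; rewrite mul1r.
by have := entry_le_norm (x - y) i; rewrite !mxE.
Qed.
End euclidean.

(* [soft_win eps x] is a lower approximation of the probability of [0 < D x] which is
   Lipschitz in [x], hence a test function for weak convergence. *)
Section soft_win.
Context {R : realType} {k : nat} {d : measure_display} {T : measurableType d}.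
Variables (P : probability T R) (D : 'rV[R]_k.+1 -> T -> R) (c : R).
Hypothesis mD : forall x, measurable_fun setT (D x).
Hypothesis lipD : forall x y w, `|D x w - D y w| <= c * `|x - y|.

Definition soft_win (eps : R) (x : 'rV[R]_k.+1) : R :=
  mean P (fun w => clamp (D x w / eps - 1)).

Let mclamp eps x : measurable_fun setT (fun w => clamp (D x w / eps - 1)).
Proof.
apply: measurable_clamp; apply: measurable_funB => //.
by apply: measurable_funM.
Qed.

Lemma soft_win_itv eps x : 0 <= soft_win eps x <= 1.
Proof. by apply: mean_itv => // w; exact: clamp_itv. Qed.

Lemma continuous_soft_win eps : 0 < eps -> continuous (soft_win eps).
Proof.
move=> eps0; apply: (lipschitz_continuous_rV _ (c / eps)) => x y.
have B w : `|clamp (D x w / eps - 1) - clamp (D y w / eps - 1)| <= c / eps * `|x - y|.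
  apply: (le_trans (clamp_lip _ _)).
  rewrite opprB addrA subrK -mulrBl normrM (gtr0_norm (x := eps^-1)) ?invr_gt0//.
  by rewrite mulrAC ler_wpM2r ?invr_ge0 ?(ltW eps0)//.
rewrite /soft_win -(meanB _ _ _ 1)//; do ?by move=> w; exact: clamp_norm.
have mB : measurable_fun setT (fun w => clamp (D x w / eps - 1) - clamp (D y w / eps - 1)).
  exact: measurable_funB.
set r := c / eps * `|x - y|.
have rr w : `|clamp (D x w / eps - 1) - clamp (D y w / eps - 1)| <= `|r|.
  by apply: (le_trans (B w)); exact: ler_norm.
rewrite ler_norml; apply/andP; split.
  rewrite -[leLHS](mean_cst P); apply: (mean_le _ _ _ `|r|) => // w.
    by rewrite normrN.
  by have := B w; rewrite ler_norml => /andP[].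
rewrite -[leRHS](mean_cst P); apply: (mean_le _ _ _ `|r|) => // w.
by have := B w; rewrite ler_norml => /andP[].
Qed.

Let mpos (e : R) x : measurable [set w | e < D x w].
Proof.
rewrite (_ : [set w | _] = ~` [set w | D x w <= e]); last first.
  by apply/seteqP; split => w /=; [move=> h; apply/negP; rewrite -ltNge|move/negP; rewrite -ltNge].
by apply: measurableC; exact: measurable_le_level.
Qed.

(** The ramp starts at [eps] and not at 0. The margin left in this way is later divided between the
    displacement of [y] and [race_coupling]. *)
Lemma soft_win_le eps x : 0 < eps -> soft_win eps x <= pr P [set w | eps < D x w].
Proof.
move=> eps0; rewrite -mean_indic//; apply: (mean_le _ _ _ 1) => //.
- by move=> w; exact: clamp_norm.
- by move=> w; rewrite indicE; case: (_ \in _); rewrite ?normr1// normr0.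
move=> w; rewrite indicE; have [h|h] := ltP eps (D x w).
  rewrite mem_set//; by case/andP: (clamp_itv (D x w / eps - 1)).
rewrite memNset; last by apply/negP; rewrite -leNgt.
by rewrite clamp_le0// subr_le0 ler_pdivrMr// mul1r.
Qed.

Lemma soft_win_cvg x :
  soft_win m.+1%:R^-1 x @[m --> \oo] --> pr P [set w | 0 < D x w].
Proof.
rewrite -mean_indic//; apply: (mean_cvg _ _ _ 1).
- by move=> n; exact: mclamp.
- by move=> n w; exact: clamp_norm.
move=> w; rewrite indicE; have [h|h] := ltP 0 (D x w).
  rewrite mem_set//; apply: cvg_near_cst; near=> m.
  apply: clamp_ge1; rewrite invrK lerBrDr -ler_pdivrMl//.
  rewrite (le_trans (ltW (truncnS_gt _)))// ler_nat ltnS.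
  by near: m; exact: nbhs_infty_ge.
rewrite memNset; last by apply/negP; rewrite -leNgt.
apply: cvg_near_cst; near=> m; apply: clamp_le0.
by rewrite subr_le0 invrK (@le_trans _ _ 0)// mulr_le0_ge0.
Unshelve. all: by end_near. Qed.

(** A pointwise limit of the continuous functions [soft_win]; joint measurability in [x] and [w] is
    not called upon. *)
Lemma measurable_win : measurable_fun setT
  ((fun x => pr P [set w | 0 < D x w]) : borel_rV R k.+1 -> R).
Proof.
apply: (@measurable_fun_cvg _ (borel_rV R k.+1) R setT (fun m => soft_win m.+1%:R^-1)) => [m|x _].
  apply: continuous_measurable_rV; apply: continuous_soft_win.
  by rewrite invr_gt0.
exact: soft_win_cvg.
Qed.
End soft_win.

(** * Payoffs *)

Lemma race_time_attained {R : realType} {k : nat} (p : 'I_k.+1 -> R) x g :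
  exists i, race_time p x g = (x ord0 i - g i) / p i.
Proof.
rewrite /race_time; apply: (big_ind (fun v => exists i, v = (x ord0 i - g i) / p i)).
- by exists ord0.
- by move=> a b [i ->] [j ->]; rewrite /Num.max; case: ifP => _; [exists j|exists i].
- by move=> i _; exists i.
Qed.

Lemma race_time_lip {R : realType} {k : nat} (p : 'I_k.+1 -> R) (pm : R) x x' g :
  0 < pm -> (forall i, pm <= p i) -> (forall i, 0 < p i) ->
  `|race_time p x g - race_time p x' g| <= pm^-1 * `|x - x'|.
Proof.
move=> pm0 pmP p0.
have key z z' : race_time p z g <= race_time p z' g + pm^-1 * `|z - z'|.
  apply: race_time_near => // i; rewrite opprB addrA subrK mulrA.
  apply: (@le_trans _ _ `|z - z'|).
    by have := entry_le_norm (z - z') i; rewrite !mxE.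
  by rewrite ler_peMl// ler_pdivlMr// mul1r.
have h1 := key x x'; have h2 := key x' x; rewrite distrC in h2.
by rewrite ler_distl; apply/andP; split; lra.
Qed.

Lemma payoffE {d : measure_display} {T : measurableType d} {R : realType}
    (P : probability T R) (S S' : T -> \bar R) :
  payoff P S S' = 2^-1 * (pr P [set w | (S w < S' w)%E] - pr P [set w | (S' w < S w)%E]).
Proof.
rewrite /payoff /beats_prob -!/(pr _ _).
have -> : [set w | S' w = S w] = [set w | S w = S' w] by apply/seteqP; split => w /=.
by congr (_ * _); ring.
Qed.

(** The half-weights of ties cancel in the payoff, and losing is contained in not winning. Counting
    ties as losses is harmless for a lower bound. *)
Lemma payoff_ge {d : measure_display} {T : measurableType d} {R : realType}
    (P : probability T R) (S S' : T -> \bar R) :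
  measurable_fun setT S -> measurable_fun setT S' ->
  pr P [set w | (S w < S' w)%E] - 2^-1 <= payoff P S S'.
Proof.
move=> mS mS'; rewrite payoffE.
have mlt (U V : T -> \bar R) : measurable_fun setT U -> measurable_fun setT V ->
    measurable [set w | (U w < V w)%E].
  by move=> mU mV; rewrite -[X in measurable X]setTI; exact: measurable_lte.
have := pr_le P [set w | (S' w < S w)%E] (~` [set w | (S w < S' w)%E]) (mlt _ _ mS' mS)
  (measurableC (mlt _ _ mS mS')).
rewrite pr_setC; last exact: mlt.
have sub : [set w | (S' w < S w)%E] `<=` ~` [set w | (S w < S' w)%E].
  by move=> w /= h; apply/negP; rewrite -leNgt ltW.
by move=> /(_ sub); lra.
Qed.

Lemma payoff_norm {d : measure_display} {T : measurableType d} {R : realType}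
    (P : probability T R) (S S' : T -> \bar R) :
  measurable_fun setT S -> measurable_fun setT S' -> `|payoff P S S'| <= 1.
Proof.
move=> mS mS'; rewrite payoffE.
have mlt (U V : T -> \bar R) : measurable_fun setT U -> measurable_fun setT V ->
    measurable [set w | (U w < V w)%E].
  by move=> mU mV; rewrite -[X in measurable X]setTI; exact: measurable_lte.
have a0 := pr_ge0 P [set w | (S w < S' w)%E]; have a1 := pr_le1 P _ (mlt _ _ mS mS').
have b0 := pr_ge0 P [set w | (S' w < S w)%E]; have b1 := pr_le1 P _ (mlt _ _ mS' mS).
by rewrite ler_norml; apply/andP; split; lra.
Qed.

Section continuous_side.
Context {R : realType} {k : nat} {d : measure_display} {T : measurableType d}.
Variables (P : probability T R) (p : 'I_k.+1 -> R) (Z : 'I_k.+1 -> {RV P >-> R}).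
Hypothesis p_gt0 : forall i, 0 < p i.
Hypothesis Z_normal : forall (i : 'I_k.+1) (B : set R), measurable B ->
     distribution P (Z i) B = normal_prob 0 1 B.
Hypothesis Z_indep : mutually_independent P (fun i : 'I_k.+1 => sigma_of (Z i)).

Local Notation X := (noise P p Z).
Local Notation tm x w := (race_time p x (X ^~ w)).

Lemma cont_timeE x w : cont_time p Z x w = (tm x w)%:E.
Proof.
have E i : x ord0 i / p i + Z i w / Num.sqrt (p i) = (x ord0 i - X i w) / p i.
  have s0 : 0 < Num.sqrt (p i) by rewrite sqrtr_gt0.
  have ss : Num.sqrt (p i) * Num.sqrt (p i) = p i by rewrite -expr2 sqr_sqrtr// ltW.
  rewrite /noise opprK mulrDl; congr (_ + _).
  by rewrite -[X in _ = _ / X]ss; field; rewrite gt_eqF.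
apply/eqP; rewrite eq_le; apply/andP; split.
  apply: bigmax_le => [|i _]; first exact: leNye.
  by rewrite lee_fin E; exact: (le_bigmax _ (fun i => (x ord0 i - X i w) / p i)).
have [i ->] := race_time_attained p x (X ^~ w).
rewrite -E.
exact: (le_bigmax _ (fun i => (x ord0 i / p i + Z i w / Num.sqrt (p i))%:E)).
Qed.

Definition win_prob (x y : 'rV[R]_k.+1) : R := pr P [set w | tm x w < tm y w].

Let mtm x : measurable_fun setT (fun w => tm x w).
Proof. by apply: measurable_race_time => i; exact: measurable_noise. Qed.

Let mpos (f : T -> R) : measurable_fun setT f -> measurable [set w | 0 < f w].
Proof.
move=> mf; rewrite (_ : [set w | _] = ~` [set w | f w <= 0]); last first.
  by apply/seteqP; split => w /=; [move=> h; apply/negP; rewrite -ltNge|move/negP; rewrite -ltNge].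
by apply: measurableC; exact: measurable_le_level.
Qed.

Lemma measurable_win_set x y : measurable [set w | tm x w < tm y w].
Proof.
rewrite (_ : [set w | _] = [set w | 0 < tm y w - tm x w]).
  by apply: mpos; exact: measurable_funB.
by apply/seteqP; split => w /=; rewrite subr_gt0.
Qed.

Lemma win_prob_itv x y : 0 <= win_prob x y <= 1.
Proof. by rewrite pr_ge0 pr_le1//; exact: measurable_win_set. Qed.

Lemma cont_payoffE x y : cont_payoff p Z x y = 2^-1 * (win_prob x y - win_prob y x).
Proof.
rewrite /cont_payoff payoffE /win_prob.
have E a b : [set w | (cont_time p Z a w < cont_time p Z b w)%E] = [set w | tm a w < tm b w].
  by apply/seteqP; split => w /=; rewrite !cont_timeE lte_fin.
by rewrite !E.
Qed.

(** Let the two maxima be attained at sides [i] and [j]. If [i = j], a tie forces [x i = y i], which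
    is excluded; otherwise it expresses one noise coordinate as a function of another, which
    [noise_neq] makes a null event. *)
Lemma tie_prob (x y : 'rV[R]_k.+1) : (forall i, x ord0 i != y ord0 i) ->
  pr P [set w | tm x w = tm y w] = 0.
Proof.
move=> xy.
pose A (ij : 'I_k.+1 * 'I_k.+1) : set T := if ij.1 == ij.2 then set0 else
  [set w | X ij.2 w = y ord0 ij.2 - p ij.2 * ((x ord0 ij.1 - X ij.1 w) / p ij.1)].
have mf i j : measurable_fun setT (fun z : R => y ord0 j - p j * ((x ord0 i - z) / p i)).
  apply: measurable_funB => //; apply: measurable_funM => //; apply: measurable_funM => //.
  exact: measurable_funB.
have mX i : measurable_fun setT (X i) by exact: measurable_noise.
have mA ij : measurable (A ij).
  rewrite /A; case: ifP => // _.
  rewrite (_ : [set w | _] = (fun w => X ij.2 w -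
      (y ord0 ij.2 - p ij.2 * ((x ord0 ij.1 - X ij.1 w) / p ij.1))) @^-1` [set 0]); last first.
    by apply/seteqP; split => w /= h; [rewrite {1}h subrr|exact: subr0_eq].
  apply: measurable_preimage => //; apply: measurable_funB => //.
  exact: measurableT_comp (mf ij.1 ij.2) (mX ij.1).
have A0 ij : pr P (A ij) = 0.
  rewrite /A; case: ifPn => [_|ij12]; first exact: pr_set0.
  exact: (noise_neq _ _ _ p_gt0 Z_normal Z_indep ij.1 ij.2 _ ij12 (mf ij.1 ij.2)).
apply/eqP; rewrite eq_le pr_ge0 andbT.
apply: (@le_trans _ _ (pr P (\big[setU/set0]_(ij <- enum {: 'I_k.+1 * 'I_k.+1}) A ij))).
  apply: pr_le.
  - rewrite (_ : [set w | _] = (fun w => tm x w - tm y w) @^-1` [set 0]); last first.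
      by apply/seteqP; split => w /= h; [rewrite h subrr|exact: subr0_eq].
    by apply: measurable_preimage => //; exact: measurable_funB.
  - exact: bigsetU_measurable.
  move=> w /= txy.
  have [i xi] := race_time_attained p x (X ^~ w).
  have [j yj] := race_time_attained p y (X ^~ w).
  rewrite (big_rem (i, j))/= ?mem_enum//; left; rewrite /A /=.
  have E : (x ord0 i - X i w) / p i = (y ord0 j - X j w) / p j by rewrite -xi -yj.
  case: eqP => [ij|_] /=.
    have := xy i; rewrite ij in E *.
    have := mulIf (invr_neq0 (lt0r_neq0 (p_gt0 j))) E.
    by move=> /addIr ->; rewrite eqxx.
  by rewrite E mulrCA divff ?mulr1 ?gt_eqF//; ring.
apply: (le_trans (pr_bigsetU_le _ _ _ _ mA)).
by rewrite big1.
Qed.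

Lemma win_prob_total (x y : 'rV[R]_k.+1) : (forall i, x ord0 i != y ord0 i) ->
  win_prob x y + win_prob y x = 1.
Proof.
move=> xy; rewrite /win_prob -pr_setU; [|exact: measurable_win_set|exact: measurable_win_set|].
- have mE : measurable [set w | tm x w = tm y w].
    rewrite (_ : [set w | _] = (fun w => tm x w - tm y w) @^-1` [set 0]); last first.
      by apply/seteqP; split => w /= h; [rewrite h subrr|exact: subr0_eq].
    by apply: measurable_preimage => //; exact: measurable_funB.
  rewrite (_ : _ `|` _ = ~` [set w | tm x w = tm y w]).
    by rewrite pr_setC// tie_prob// subr0.
  apply/seteqP; split => w /=.
    by move=> [|] h; apply/eqP; [rewrite lt_eqF|rewrite gt_eqF].
  by move/eqP; rewrite neq_lt => /orP.
- apply/seteqP; split => // w [/= h1 h2].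
  by have := lt_trans h1 h2; rewrite ltxx.
Qed.

Let margin (y x : 'rV[R]_k.+1) (w : T) : R := tm y w - tm x w.

Let mmargin y x : measurable_fun setT (margin y x).
Proof. exact: measurable_funB. Qed.

Lemma measurable_win_prob (y : 'rV[R]_k.+1) :
  measurable_fun setT ((win_prob ^~ y) : borel_rV R k.+1 -> R) /\
  measurable_fun setT (win_prob y : borel_rV R k.+1 -> R).
Proof.
have [pm pm0 pmP] := min_rate p p_gt0.
split.
- have := measurable_win P (margin y) pm^-1 (mmargin y).
  rewrite (_ : (fun x => pr P [set w | 0 < margin y x w]) = win_prob ^~ y).
    apply => x x' w; rewrite /margin (_ : _ - _ = - (tm x w - tm x' w)) ?normrN; last by ring.
    exact: race_time_lip.
  by apply/funext => x; congr pr; apply/seteqP; split => w /=; rewrite /margin subr_gt0.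
- have := measurable_win P (fun x w => - margin y x w) pm^-1.
  rewrite (_ : (fun x => pr P [set w | 0 < - margin y x w]) = win_prob y).
    apply => [x|x x' w]; first exact: measurableT_comp.
    rewrite (_ : - margin y x w - - margin y x' w = tm x w - tm x' w); last first.
      by rewrite /margin; ring.
    exact: race_time_lip.
  by apply/funext => x; congr pr; apply/seteqP; split => w /=; rewrite /margin opprB subr_gt0.
Qed.

Lemma cont_mixed_payoff_eq (alpha : probability (borel_rV R k.+1) R) (y : 'rV[R]_k.+1) :
  (forall i, atomless (marginal alpha i)) ->
  cont_mixed_payoff p Z alpha y = (mean alpha (win_prob ^~ y) - 2^-1)%:E.
Proof.
move=> atl; have [m1 m2] := measurable_win_prob y.
have n1 x : `|win_prob x y| <= 1 by have /andP[h0 h1] := win_prob_itv x y; rewrite ger0_norm.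
rewrite -[2^-1](mean_cst alpha) -(meanB _ _ _ 1)//; last first.
  by move=> _; rewrite ger0_norm//; lra.
rewrite -(mean_EFin _ _ 2); [|exact: measurable_funB|]; last first.
  move=> x; have /andP[h0 h1] := win_prob_itv x y.
  by rewrite ler_norml; apply/andP; split; lra.
rewrite /cont_mixed_payoff; apply: ae_eq_integral => //.
- apply/measurable_EFinP.
  rewrite (_ : (fun x => cont_payoff p Z x y) = (fun x => 2^-1 * (win_prob x y - win_prob y x))).
    by apply: measurable_funM => //; exact: measurable_funB.
  by apply/funext => x; exact: cont_payoffE.
- by apply/measurable_EFinP; exact: measurable_funB.
pose N i : set (borel_rV R k.+1) := [set x : 'rV[R]_k.+1 | x ord0 i = y ord0 i].
have mN i : measurable (N i).
  exact: (measurable_preimage _ (continuous_measurable_rV _ (continuous_entry (R := R) i)) _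
    (measurable_set1 _)).
have N0 i : alpha (N i) = 0%E by exact: (atl i (y ord0 i)).
exists (\big[setU/set0]_(i < k.+1) N i); split.
- exact: bigsetU_measurable.
- apply: (etrans (pr_EFin alpha _ _)); first exact: bigsetU_measurable.
  congr EFin; apply/eqP; rewrite eq_le pr_ge0 andbT.
  apply: (le_trans (pr_bigsetU_le _ _ _ _ mN)).
  by rewrite big1// => i _; rewrite /pr N0.
move=> x /= h; apply: contrapT => nN; apply: h => _.
congr EFin; rewrite cont_payoffE.
have xy i : x ord0 i != y ord0 i.
  by apply/eqP => xyi; apply: nN; rewrite (bigD1 i)//=; left.
by have := win_prob_total x y xy; lra.
Qed.
End continuous_side.

(** * Passing to the limit *)

Lemma weak_cvg_mean {R : realType} {k : nat}
    (mu_ : nat -> probability (borel_rV R k.+1) R) (mu : probability (borel_rV R k.+1) R)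
    (f : 'rV[R]_k.+1 -> R) (c : R) :
  weak_cvg mu_ mu -> continuous f -> (forall x, `|f x| <= c) ->
  mean (mu_ n) f @[n --> \oo] --> mean mu f.
Proof.
move=> wc cf fc.
have bf : bounded_fun f.
  exists c; split; first exact: num_real.
  by move=> M cM x _ /=; apply: le_trans (fc x) (ltW cM).
have := wc f cf bf.
rewrite (mean_EFin mu f c (continuous_measurable_rV _ cf) fc).
by move=> /fine_cvg.
Qed.

Section cutoff.
Context {R : realType} {k : nat}.

(** [race_coupling] speaks of bounded [x] only. Multiplying a test function by the cutoff turns its
    value outside a ball into 0, a trivial lower bound for a probability. *)
Definition cutoff (m : nat) (x : 'rV[R]_k.+1) : R := clamp (m%:R + 1 - `|x|).

Lemma continuous_cutoff m : continuous (cutoff m).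
Proof.
apply: (lipschitz_continuous_rV _ 1) => x y; rewrite mul1r.
apply: (le_trans (clamp_lip _ _)).
rewrite (_ : _ - _ = `|y| - `|x|); last by ring.
by rewrite distrC; exact: ler_dist_dist.
Qed.

Lemma cutoff_cvg x : cutoff m x @[m --> \oo] --> (1 : R).
Proof.
apply: cvg_near_cst; near=> m; apply: clamp_ge1.
rewrite lerBrDr addrC lerD2r (le_trans (ltW (truncnS_gt _)))// ler_nat.
by near: m; exact: nbhs_infty_ge.
Unshelve. all: by end_near. Qed.

Lemma cutoff_eq0 m x : m%:R + 1 <= `|x| -> cutoff m x = 0.
Proof. by move=> h; rewrite /cutoff clamp_le0// subr_le0. Qed.
End cutoff.

Section token_side.
Context {R : realType} {k : nat} {d : measure_display} {T : measurableType d}.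
Variables (P : probability T R) (p : 'I_k.+1 -> R) (Y : 'I_k.+1 -> R -> {RV P >-> nat}).
Hypothesis Y_poisson : forall i, poisson_process (p i) (Y i).

Definition token_win_prob (n : nat) (x y : 'rV[R]_k.+1) : R :=
  pr P [set w | (clearance_time Y (tokens p n x) w < clearance_time Y (tokens p n y) w)%E].

Let measurable_finite (A : set 'rV[R]_k.+1) : finite_set A ->
  measurable (A : set (borel_rV R k.+1)).
Proof.
move=> fA; apply: countable_measurable; last exact: finite_set_countable.
move=> x; apply: measurable_closed; apply: accessible_closed_set1.
exact/hausdorff_accessible/norm_hausdorff.
Qed.

(** Weak convergence integrates over the whole space, the token payoff over a finite set. The
    complement of that set is null for [mu], and [2^-1] comes from [payoff_ge]. *)
Lemma token_mixed_payoff_ge (n : nat) (mu : probability (borel_rV R k.+1) R)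
    (u : 'rV[R]_k.+1 -> R) (y : 'rV[R]_k.+1) (e : R) :
  mu (normalized_allocation p n) = 1%E ->
  measurable_fun setT (u : borel_rV R k.+1 -> R) -> (forall x, 0 <= u x <= 1) -> 0 <= e ->
  (forall x, normalized_allocation p n x -> u x - e <= token_win_prob n x y) ->
  ((mean mu u - (e + 2^-1))%:E <= token_mixed_payoff p n Y mu y)%E.
Proof.
move=> muA mu_ u01 e0 ule.
have finA := finite_normalized_allocation p n.
have mA : measurable (normalized_allocation p n : set (borel_rV R k.+1)).
  exact: measurable_finite.
have uc x : `|u x| <= e + 1.
  by have /andP[h0 h1] := u01 x; rewrite ger0_norm//; lra.
rewrite -[e + 2^-1](mean_cst mu) -(meanB _ _ _ (e + 1))//; last first.
  by move=> _; rewrite ger0_norm; lra.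
have mv : measurable_fun setT ((fun x => u x - (e + 2^-1)) : borel_rV R k.+1 -> R).
  exact: measurable_funB.
have vc x : `|u x - (e + 2^-1)| <= e + 1.
  by have /andP[h0 h1] := u01 x; rewrite ler_norml; apply/andP; split; lra.
rewrite -(mean_EFin mu _ _ mv vc).
rewrite (negligible_integral (measurableC mA)) //; last 2 first.
- exact: (integrable_of_bounded mu _ _ mv vc).
- by have := probability_setC mu mA; rewrite [X in (_ - X)%E]muA subee.
rewrite setTD setCK /token_mixed_payoff.
have mtime xi : measurable_fun setT (clearance_time Y xi).
  exact: (measurable_clearance_time _ _ _ Y_poisson).
apply: le_integral => //.
- by apply: (integrableS measurableT) => //; exact: (integrable_of_bounded mu _ _ mv vc).
- apply: measurable_bounded_integrable => //.
  + by rewrite (le_lt_trans (probability_le1 _ _))// ltry.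
  (* Inside the finite set of allocations every preimage is finite, hence Borel, so the token payoff
     is measurable there. *)
  + move=> _ B mB; apply: measurable_finite.
    by apply: sub_finite_set finA => x [].
  + exists 1; split; first exact: num_real.
    move=> M cM x _ /=; apply: le_trans (ltW cM).
    exact: payoff_norm.
move=> x /set_mem Ax; rewrite lee_fin.
have := payoff_ge P (clearance_time Y (tokens p n x)) (clearance_time Y (tokens p n y))
  (mtime _) (mtime _).
have := ule x Ax; rewrite /token_payoff -/(token_win_prob n x y); lra.
Qed.
End token_side.

Section convergence.
Context {R : realType} {k : nat}.
Context {d1 d2 : measure_display} {T1 : measurableType d1} {T2 : measurableType d2}.
Variables (p : 'I_k.+1 -> R) (P1 : probability T1 R) (Z : 'I_k.+1 -> {RV P1 >-> R}).
Variables (P2 : probability T2 R) (Y : 'I_k.+1 -> R -> {RV P2 >-> nat}).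
Hypothesis p_gt0 : forall i, 0 < p i.
Hypothesis p_sum1 : \sum_(i < k.+1) p i = 1.
Hypothesis Z_normal : forall (i : 'I_k.+1) (B : set R), measurable B ->
     distribution P1 (Z i) B = normal_prob 0 1 B.
Hypothesis Z_indep : mutually_independent P1 (fun i : 'I_k.+1 => sigma_of (Z i)).
Hypothesis Y_poisson : forall i : 'I_k.+1, poisson_process (p i) (Y i).
Hypothesis Y_indep :
  mutually_independent P2 (fun i : 'I_k.+1 => sigma_of_process (Y i)).
Variables (alpha_ : nat -> probability (borel_rV R k.+1) R)
  (alpha : probability (borel_rV R k.+1) R).
Hypothesis alpha_mixed : forall n, (0 < n)%N -> alpha_ n (normalized_allocation p n) = 1%E.
Hypothesis alpha_cvg : weak_cvg alpha_ alpha.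

Local Notation X := (noise P1 p Z).
Local Notation tm x w := (race_time p x (X ^~ w)).

Let mtm x : measurable_fun setT (fun w => tm x w).
Proof. by apply: measurable_race_time => i; exact: measurable_noise. Qed.

Let mgap (r : R) x y : measurable [set w | tm x w + r < tm y w].
Proof.
rewrite (_ : [set w | _] = ~` [set w | tm y w - (tm x w + r) <= 0]); last first.
  apply/seteqP; split => w /=; first by move=> h; apply/negP; rewrite -ltNge subr_gt0.
  by move/negP; rewrite -ltNge subr_gt0.
apply: measurableC; apply: (measurable_le_level (fun w => tm y w - (tm x w + r))).
by apply: measurable_funB => //; exact: measurable_funD.
Qed.

Let bounded_entries (m : nat) (x : 'rV[R]_k.+1) : ~ (m%:R + 1 <= `|x|) ->
  forall i, `|x ord0 i| <= m%:R + 1.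
Proof.
by move=> /negP; rewrite -ltNge => h i; exact: le_trans (entry_le_norm x i) (ltW h).
Qed.

(** Being joint in [y'] near [y] and large [n], the estimate has the form that a compactness
    argument consumes. The loss [e] splits into [e / 2] for replacing the winning probability by
    [u m], [e / 4] for weak convergence and [e / 4] for [race_coupling]. *)
Lemma token_mixed_near (y : 'rV[R]_k.+1) (e : R) : 0 < e ->
  \forall y' \near y & n \near \oo, normalized_allocation p n y' ->
  ((mean alpha (win_prob P1 p Z ^~ y) - 2^-1 - e)%:E <=
   token_mixed_payoff p n Y (alpha_ n) y')%E.
Proof.
move=> e0.
have [pm pm0 pmP] := min_rate p p_gt0.
pose D (x : 'rV[R]_k.+1) w := tm y w - tm x w.
have mD x : measurable_fun setT (D x) by exact: measurable_funB.
have lipD x x' w : `|D x w - D x' w| <= pm^-1 * `|x - x'|.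
  rewrite (_ : _ - _ = - (tm x w - tm x' w)) ?normrN; last by rewrite /D; ring.
  exact: race_time_lip.
pose u m (x : 'rV[R]_k.+1) := cutoff m x * soft_win P1 D m.+1%:R^-1 x.
have u01 m x : 0 <= u m x <= 1.
  have /andP[a0 a1] := soft_win_itv P1 D mD m.+1%:R^-1 x.
  have /andP[b0 b1] := clamp_itv (m%:R + 1 - `|x|).
  by rewrite /u mulr_ge0//= mulr_ile1.
have un m x : `|u m x| <= 1 by have /andP[h0 h1] := u01 m x; rewrite ger0_norm.
have cu m : continuous (u m).
  move=> x; apply: continuousM; first exact: continuous_cutoff.
  by apply: (continuous_soft_win P1 D _ mD lipD); rewrite invr_gt0.
have uE x : u m x @[m --> \oo] --> win_prob P1 p Z x y.
  rewrite -[X in _ --> X]mul1r; apply: cvgM; first exact: cutoff_cvg.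
  rewrite /win_prob (_ : [set w | _] = [set w | 0 < D x w]); first exact: soft_win_cvg.
  by apply/seteqP; split => w /=; rewrite /D subr_gt0.
have mu_cvg : mean alpha (u m) @[m --> \oo] --> mean alpha (win_prob P1 p Z ^~ y).
  apply: (mean_cvg _ _ _ 1) => // m; exact: continuous_measurable_rV.
have e40 : 0 < e / 4 by rewrite divr_gt0.
have [m um] : exists m, mean alpha (win_prob P1 p Z ^~ y) - e / 2 <= mean alpha (u m).
  have [m _ /(_ m (leqnn m))] : \forall m \near \oo,
      mean alpha (win_prob P1 p Z ^~ y) - e / 2 < mean alpha (u m).
    by apply: (cvgr_gt _ mu_cvg); lra.
  by move=> h; exists m; exact: ltW.
(* Half of the margin of [soft_win] is spent on [race_coupling], the other half on moving [y] to
   [y']. *)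
pose r : R := m.+1%:R^-1 / 2.
have m0 : 0 < m.+1%:R^-1 :> R by rewrite invr_gt0.
have r0 : 0 < r by rewrite divr_gt0.
have M0 : 0 <= m%:R + 1 :> R by rewrite addr_ge0.
have race := race_coupling p P1 Z P2 Y p_gt0 p_sum1 Z_normal Z_indep Y_poisson Y_indep
  r (e / 4) (m%:R + 1) r0 e40 M0.
have mean_n : \forall n \near \oo, mean alpha (u m) - e / 4 < mean (alpha_ n) (u m).
  have h := weak_cvg_mean alpha_ alpha (u m) 1 alpha_cvg (cu m) (un m).
  by apply: (cvgr_gt _ h); lra.
have near_y : \forall y' \near y, `|y - y'| <= pm * r.
  apply/(@nbhs_normP _ 'rV[R]_k.+1); exists (pm * r); first by rewrite /= mulr_gt0.
  by move=> y' /= /ltW.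
have near_n : \forall n \near \oo, [/\ (0 < n)%N,
    mean alpha (u m) - e / 4 < mean (alpha_ n) (u m) &
    forall x y : 'rV[R]_k.+1, normalized_allocation p n x -> normalized_allocation p n y ->
    (forall i, `|x ord0 i| <= m%:R + 1) ->
    pr P1 [set w | tm x w + r < tm y w] <= token_win_prob P2 p Y n x y + e / 4].
  near=> n; split; [by near: n; exists 1%N|by near: n|by near: n].
exists ([set y' | `|y - y'| <= pm * r], [set n | [/\ (0 < n)%N,
    mean alpha (u m) - e / 4 < mean (alpha_ n) (u m) &
    forall x y : 'rV[R]_k.+1, normalized_allocation p n x -> normalized_allocation p n y ->
    (forall i, `|x ord0 i| <= m%:R + 1) ->
    pr P1 [set w | tm x w + r < tm y w] <= token_win_prob P2 p Y n x y + e / 4]]); first by split.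
move=> [y' n] /= [yy' [n0 mn race_n]] Ay'.
apply: le_trans (token_mixed_payoff_ge P2 p Y Y_poisson n (alpha_ n) (u m) y' (e / 4)
  (alpha_mixed n n0) _ (u01 m) (ltW e40) _).
- by rewrite lee_fin; move: um mn; lra.
- exact: continuous_measurable_rV.
move=> x Ax; have [far|close] := pselect (m%:R + 1 <= `|x|).
  by rewrite /u cutoff_eq0// mul0r sub0r (le_trans _ (pr_ge0 _ _))// oppr_le0 ltW.
rewrite lerBlDr; apply: le_trans (race_n x y' Ax Ay' (bounded_entries m x close)).
have /andP[a0 a1] := soft_win_itv P1 D mD m.+1%:R^-1 x.
apply: (@le_trans _ _ (soft_win P1 D m.+1%:R^-1 x)).
  by rewrite /u ler_piMl//; case/andP: (clamp_itv (m%:R + 1 - `|x|)).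
apply: (le_trans (soft_win_le P1 D mD _ _ m0)).
apply: pr_le => //.
  rewrite (_ : [set w | _] = [set w | tm x w + m.+1%:R^-1 < tm y w]) //.
  by apply/seteqP; split => w /=; rewrite /D ltrBrDl.
move=> w /=; rewrite /D ltrBrDl => h.
have := race_time_lip p pm y y' (X ^~ w) pm0 pmP p_gt0.
have b : pm^-1 * `|y - y'| <= r by rewrite ler_pdivrMl.
rewrite ler_norml => /andP[_ h2].
have rr : r + r = m.+1%:R^-1 by rewrite /r -splitr.
by move: h h2 b; rewrite -rr; lra.
Unshelve. all: by end_near. Qed.

Lemma rate_le1 i : p i <= 1.
Proof. by rewrite -p_sum1 (bigD1 i)//= lerDl sumr_ge0// => j _; exact: ltW. Qed.

(** Here the cutoff alone is the test function. Its mean under the limit is close to 1, so weak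
    convergence makes [alpha_ n] put almost all its mass on a fixed ball; against such [x] a large
    coordinate of [y] loses whenever the noise is moderate. *)
Lemma token_mixed_far (e : R) : 0 < e -> exists L : R, \forall n \near \oo,
  forall y, normalized_allocation p n y -> (exists i, L <= y ord0 i) ->
  ((2^-1 - e)%:E <= token_mixed_payoff p n Y (alpha_ n) y)%E.
Proof.
move=> e0; have [pm pm0 pmP] := min_rate p p_gt0.
have e40 : 0 < e / 4 by rewrite divr_gt0.
have cut01 m (x : 'rV[R]_k.+1) : 0 <= cutoff m x <= 1 by exact: clamp_itv.
have cutn m (x : 'rV[R]_k.+1) : `|cutoff m x| <= 1 by exact: clamp_norm.
have [m um] : exists m, 1 - e / 4 < mean alpha (cutoff m).
  have h : mean alpha (cutoff m) @[m --> \oo] --> (1 : R).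
    rewrite -[X in _ --> X](mean_cst alpha); apply: (mean_cvg _ _ _ 1) => // [m|x].
      by apply: continuous_measurable_rV; exact: continuous_cutoff.
    exact: cutoff_cvg.
  have [m _ /(_ m (leqnn m))] : \forall m \near \oo, 1 - e / 4 < mean alpha (cutoff m).
    by apply: (cvgr_gt _ h); lra.
  by exists m.
have mean_n : \forall n \near \oo, 1 - e / 4 < mean (alpha_ n) (cutoff m).
  have h := weak_cvg_mean alpha_ alpha (cutoff m) 1 alpha_cvg (continuous_cutoff m) (cutn m).
  exact: (cvgr_gt _ h).
have M0 : 0 <= m%:R + 1 :> R by rewrite addr_ge0.
have race := race_coupling p P1 Z P2 Y p_gt0 p_sum1 Z_normal Z_indep Y_poisson Y_indep
  1 (e / 4) (m%:R + 1) ltr01 e40 M0.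
have k0 : 0 < k.+1%:R :> R by rewrite ltr0n.
have [K [K0 KP]] : exists K : R, 0 < K /\ forall i, pr P1 [set w | K <= `|X i w|] <= e / 4 / k.+1%:R.
  near (+oo : set_system R) => K; exists K; split.
    by near: K; exact: nbhs_pinfty_gt.
  near: K; apply: filter_forall => i.
  by apply: pr_abs_tail; [exact: measurable_noise|rewrite !divr_gt0].
pose B := (m%:R + 1 + K) / pm.
have B0 : 0 <= B by rewrite divr_ge0 ?addr_ge0 ?(ltW K0)// ltW.
(* With all noises below [K], the race time of [x] is at most [B], while the large coordinate gives
   [B + 2 <= p i0 * tm y w]. As [p i0 <= 1], [y] is slower by more than the margin 1 of [race]. *)
exists (K + B + 2); near=> n => y Ay [i0 yL].
have n0 : (0 < n)%N by near: n; exists 1%N.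
have mn : 1 - e / 4 < mean (alpha_ n) (cutoff m) by near: n.
have race_n : forall x y : 'rV[R]_k.+1, normalized_allocation p n x -> normalized_allocation p n y ->
    (forall i, `|x ord0 i| <= m%:R + 1) ->
    pr P1 [set w | tm x w + 1 < tm y w] <= token_win_prob P2 p Y n x y + e / 4 by near: n.
apply: le_trans (token_mixed_payoff_ge P2 p Y Y_poisson n (alpha_ n) (cutoff m) y (e / 2)
  (alpha_mixed n n0) _ (cut01 m) _ _).
- by rewrite lee_fin; move: mn; lra.
- by apply: continuous_measurable_rV; exact: continuous_cutoff.
- by rewrite divr_ge0// ltW.
move=> x Ax; have [far|close] := pselect (m%:R + 1 <= `|x|).
  by rewrite cutoff_eq0// sub0r (le_trans _ (pr_ge0 _ _))// oppr_le0 divr_ge0// ltW.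
have xM := bounded_entries m x close.
have := race_n x y Ax Ay xM.
suff : 1 - e / 4 <= pr P1 [set w | tm x w + 1 < tm y w].
  by have /andP[_ c1] := cut01 m x; lra.
pose tail := \big[setU/set0]_(i < k.+1) [set w | K <= `|X i w|].
have mtaili i : measurable [set w | K <= `|X i w|].
  by apply: measurable_abs_level; exact: measurable_noise.
have mtail : measurable tail by exact: bigsetU_measurable.
have ptail : pr P1 tail <= e / 4.
  apply: (le_trans (pr_bigsetU_le _ _ _ _ mtaili)).
  apply: (@le_trans _ _ (\sum_(i < k.+1) (e / 4 / k.+1%:R))); first exact: ler_sum.
  by rewrite sumr_const card_ord -[leLHS]mulr_natr divfK ?gt_eqF.
apply: (@le_trans _ _ (pr P1 (~` tail))); first by rewrite pr_setC//; lra.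
apply: pr_le => //; first exact: measurableC.
move=> w ntail /=.
have Xlt i : `|X i w| < K.
  rewrite ltNge; apply/negP => Kle; apply: ntail.
  by rewrite /tail (bigD1 i)//=; left.
have tx : tm x w <= B.
  apply: race_time_le => // i.
  have pB : m%:R + 1 + K <= p i * B.
    by rewrite /B mulrCA ler_peMr ?addr_ge0 ?(ltW K0)// ler_pdivlMr// mul1r; exact: pmP.
  have := xM i; have := ltW (Xlt i); rewrite !ler_norml => /andP[g1 _] /andP[_ x1].
  by move: g1 x1 pB; lra.
have ty : B + 2 <= p i0 * tm y w.
  have := le_race_time p p_gt0 y (X ^~ w) i0.
  have := ltW (Xlt i0); rewrite ler_norml => /andP[_ g1].
  by move: yL g1; lra.
have ty0 : 0 <= tm y w by rewrite -(pmulr_rge0 _ (p_gt0 i0)); lra.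
have := ler_wpM2r ty0 (rate_le1 i0); rewrite mul1r.
by move: tx ty; lra.
Unshelve. all: by end_near. Qed.
End convergence.

(** * Compactness of bounded allocations and conclusion *)

(** Upper bounds suffice: the entries sum to 0, so a very negative entry would force a large one.
    This is why [token_mixed_far] only treats large positive coordinates. *)
Lemma compact_allocations {R : realType} {k : nat} (L : R) :
  compact ([set y | allocation y /\ forall i, y ord0 i <= L] : set 'rV[R]_k.+1).
Proof.
apply: bounded_closed_compact.
  exists (k.+1%:R * `|L|); split; first exact: num_real.
  move=> M LM y /= [y0 yL]; apply: le_trans (ltW LM).
  rewrite [leLHS]/Num.norm /= mx_normrE; apply: bigmax_le; first by rewrite mulr_ge0.
  move=> [i j] _ /=; rewrite (ord1 i).
  have up l : y ord0 l <= `|L| by apply: le_trans (yL l) (ler_norm L).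
  rewrite ler_norml; apply/andP; split; last first.
    apply: (le_trans (up j)); rewrite -[leLHS]mul1r ler_wpM2r//.
    by rewrite -[leLHS]/(1%:R) ler_nat.
  have : y ord0 j = - (\sum_(l < k.+1 | l != j) y ord0 l).
    by move: y0; rewrite /allocation /= (bigD1 j)//= => /eqP; rewrite addr_eq0 => /eqP.
  move=> ->; rewrite lerN2.
  apply: (@le_trans _ _ (\sum_(l < k.+1 | l != j) `|L|)); first exact: ler_sum.
  apply: (@le_trans _ _ (\sum_(l < k.+1) `|L|)).
    by rewrite [leRHS](bigD1 j)//= lerDr.
  by rewrite sumr_const card_ord [leRHS]mulr_natl.
have c1 : continuous (fun y : 'rV[R]_k.+1 => \sum_(i < k.+1) y ord0 i).
  apply: (lipschitz_continuous_rV _ k.+1%:R) => x y.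
  rewrite -sumrB (le_trans (ler_norm_sum _ _ _))//.
  apply: (@le_trans _ _ (\sum_(i < k.+1) `|x - y|)).
    by apply: ler_sum => i _; have := entry_le_norm (x - y) i; rewrite !mxE.
  by rewrite sumr_const card_ord -[leLHS]mulr_natl.
have -> : [set y | allocation y /\ forall i, y ord0 i <= L] =
    ((fun y : 'rV[R]_k.+1 => \sum_(i < k.+1) y ord0 i) @^-1` [set 0]) `&`
    \bigcap_(i in [set: 'I_k.+1]) ((fun y : 'rV[R]_k.+1 => y ord0 i) @^-1` [set z | z <= L]).
  by apply/seteqP; split => y /= [y0 yL]; split => // i; [move=> _|]; exact: yL.
apply: closedI; first by move/continuous_closedP : c1; apply; exact: closed_eq.
apply: closed_bigI => i _.
by move/continuous_closedP : (@continuous_entry R k i); apply; exact: closed_le.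
Qed.

Lemma le_limn_einf {R : realType} (u : nat -> \bar R) (v : \bar R) :
  (\forall n \near \oo, (v <= u n)%E) -> (v <= limn_einf u)%E.
Proof.
move=> [N _ vu]; rewrite limn_einf_lim; apply: lime_ge; first exact: is_cvg_einfs.
exists N => // n /= Nn; apply: le_ereal_inf_tmp => _ [m /= nm <-].
by apply: vu => /=; exact: leq_trans nm.
Qed.

Theorem theorem4p1 (R : realType) (k : nat) (p : 'I_k -> R)
  (k_gt0 : (0 < k)%N)
  (p_gt0 : forall i, 0 < p i)
  (p_sum1 : \sum_(i < k) p i = 1)
  (d1 : measure_display) (T1 : measurableType d1) (P1 : probability T1 R)
  (Z : 'I_k -> {RV P1 >-> R})
  (Z_normal : forall (i : 'I_k) (B : set R), measurable B ->
     distribution P1 (Z i) B = normal_prob 0 1 B)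
  (Z_indep : mutually_independent P1 (fun i : 'I_k => sigma_of (Z i)))
  (d2 : measure_display) (T2 : measurableType d2) (P2 : probability T2 R)
  (Y : 'I_k -> R -> {RV P2 >-> nat})
  (Y_poisson : forall i : 'I_k, poisson_process (p i) (Y i))
  (Y_indep : mutually_independent P2 (fun i : 'I_k => sigma_of_process (Y i)))
  (alpha_ : nat -> probability (borel_rV R k) R)
  (alpha_mixed : forall n, (0 < n)%N ->
     alpha_ n (normalized_allocation p n) = 1%E)
  (alpha : probability (borel_rV R k) R)
  (alpha_alloc : alpha allocation = 1%E)
  (alpha_cvg : weak_cvg alpha_ alpha)
  (alpha_atomless : forall i : 'I_k, atomless (marginal alpha i))
  (alpha_bounded : bounded_set (topological_support alpha)) :
  (ereal_inf [set cont_mixed_payoff p Z alpha y | y in allocation]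
   <= limn_einf (fun n : nat =>
        \big[mine/+oo]_(y \in normalized_allocation p n)
           token_mixed_payoff p n Y (alpha_ n) y))%E.
Proof.
case: k p k_gt0 p_gt0 p_sum1 Z Z_normal Z_indep Y Y_poisson Y_indep alpha_ alpha_mixed
  alpha alpha_alloc alpha_cvg alpha_atomless alpha_bounded => // k p _ p_gt0 p_sum1
  Z Z_normal Z_indep Y Y_poisson Y_indep alpha_ alpha_mixed alpha alpha_alloc
  alpha_cvg alpha_atomless alpha_bounded.
set V := ereal_inf _.
have V_le (y : 'rV[R]_k.+1) : allocation y ->
    (V <= (mean alpha (win_prob P1 p Z ^~ y) - 2^-1)%:E)%E.
  move=> ay; rewrite -(cont_mixed_payoff_eq P1 p Z p_gt0 Z_normal Z_indep alpha y alpha_atomless).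
  by apply: ereal_inf_lbound; exists y.
(* The target is at most the best conceivable payoff, so allocations that lose almost surely cannot
   lower the bound. *)
have V_half : (V <= (2^-1)%:E)%E.
  apply: (le_trans (V_le 0 _)).
    by rewrite /allocation /=; apply: big1 => i _; rewrite mxE.
  rewrite lee_fin.
  have [m1 _] := measurable_win_prob P1 p Z p_gt0 (0 : 'rV[R]_k.+1).
  have /andP[_] := mean_itv alpha _ m1 (fun x => win_prob_itv P1 p Z x 0).
  by lra.
apply/lee_subgt0Pr => e e0; apply: le_limn_einf.
have [L far] := token_mixed_far p P1 Z P2 Y p_gt0 p_sum1 Z_normal Z_indep Y_poisson
  Y_indep alpha_ alpha alpha_mixed alpha_cvg e e0.
have close : \forall n \near \oo,
    [set y : 'rV[R]_k.+1 | allocation y /\ forall i, y ord0 i <= L] `<=`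
    (fun y => normalized_allocation p n y -> (V - e%:E <= token_mixed_payoff p n Y (alpha_ n) y)%E).
  (* Compactness turns the local estimates into a single threshold on [n] for all these [y]. *)
  have /compact_near_coveringP/(_ nat \oo) := @compact_allocations R k L.
  apply => y [ay _].
  apply: filterS (token_mixed_near p P1 Z P2 Y p_gt0 p_sum1 Z_normal Z_indep Y_poisson
    Y_indep alpha_ alpha alpha_mixed alpha_cvg y e e0) => -[y' n] /= h Ay'.
  by apply: le_trans (h Ay'); rewrite EFinB leeD2r// V_le.
near=> n.
have n0 : (0 < n)%N by near: n; exists 1%N.
rewrite fsbig_finite; last exact: finite_normalized_allocation.
rewrite big_seq; apply: le_bigmin => [|y]; first exact: leey.
rewrite in_fset_set ?inE; last exact: finite_normalized_allocation.
move=> Ay.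
have [yL|/existsNP[i /negP]] := pselect (forall i, y ord0 i <= L).
  have close_n : [set y : 'rV[R]_k.+1 | allocation y /\ forall i, y ord0 i <= L] `<=`
    (fun y => normalized_allocation p n y -> (V - e%:E <= token_mixed_payoff p n Y (alpha_ n) y)%E).
    by near: n.
  by apply: close_n => //; split => //; exact: normalized_allocation_sum0 Ay.
rewrite -ltNge => /ltW Ly.
have far_n : forall y, normalized_allocation p n y -> (exists i, L <= y ord0 i) ->
  ((2^-1 - e)%:E <= token_mixed_payoff p n Y (alpha_ n) y)%E by near: n.
apply: (le_trans _ (far_n y Ay _)); last by exists i.
by rewrite EFinB leeD2r.
Unshelve. all: by end_near. Qed.
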